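(* Let $G'_3$ be the graph on $10$ vertices consisting of a clique $B=\{b_1,b_2,b_3,b_4\}$, a clique $R=\{r_A : A\subseteq\{1,2,3,4\},\ |A|=2\}$ (six vertices), and, between the two cliques, exactly the edges $b_i r_A$ with $i\in A$. Then the obstacle number of $G'_3$ is greater than $1$.
   Context: An obstacle representation of a graph $G$ consists of a finite set $P$ of points in the plane together with a finite set of closed polygonal obstacles (disjoint from $P$) such that the points of $P$ together with the vertices of the obstacles are in general position (no three collinear), and such that the visibility graph is isomorphic to $G$; the visibility graph has vertex set $P$, with $p,q$ adjacent iff the segment $pq$ meets no obstacle. The obstacle number of $G$ is the minimum number of obstacles over all obstacle representations of $G$. *)

(* Defs.v *)
From mathcomp Require Import all_boot all_order all_algebra finmap.
From mathcomp Require Import all_classical all_reals all_analysis.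

Set Implicit Arguments.
Unset Strict Implicit.
Unset Printing Implicit Defensive.

Import Order.TTheory GRing.Theory Num.Theory.
Import numFieldNormedType.Exports.

Local Open Scope classical_set_scope.
Local Open Scope ring_scope.

Record sgraph := SGraph {
  vertex :> finType ;
  adj : rel vertex ;
  adj_sym : symmetric adj ;
  adj_irr : irreflexive adj }.

Definition graph_iso (G H : sgraph) : Prop :=
  exists f : G -> H,
    bijective f /\ forall x y : G, adj (f x) (f y) = adj x y.

Notation plane R := (R * R)%type (only parsing).

Definition segment (R : realType) (p q : plane R) : set (plane R) :=
  [set (1 - t) *: p + t *: q | t in `[0, 1]].

Definition collinear (R : realType) (p q r : plane R) : Prop :=
  (q.1 - p.1) * (r.2 - p.2) - (q.2 - p.2) * (r.1 - p.1) = 0.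

Definition general_position (R : realType) (S : set (plane R)) : Prop :=
  forall p q r, S p -> S q -> S r -> p <> q -> q <> r -> p <> r ->
    ~ collinear p q r.

(* A polygon is given by the cyclic sequence of its vertices; since the
   vertices are distinct, each side is determined by its first endpoint. *)
Definition side (R : realType) (s : seq (plane R)) (v : plane R) :
  set (plane R) := segment v (next s v).

Definition simple_polygon (R : realType) (s : seq (plane R)) : Prop :=
  [/\ uniq s, (2 < size s)%N &
      forall v w, v \in s -> w \in s -> v != w ->
        side s v `&` side s w `<=`
          [set` [:: v; next s v]] `&` [set` [:: w; next s w]] ].

Definition boundary (R : realType) (s : seq (plane R)) : set (plane R) :=
  \bigcup_(v in [set` s]) side s v.

(* The inside of a polygon consists of the bounded connected components of the
   complement of its boundary. *)
Definition inside (R : realType) (s : seq (plane R)) : set (plane R) :=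
  [set x | ~ boundary s x /\
           bounded_set (connected_component (~` boundary s) x)].

Definition region (R : realType) (s : seq (plane R)) : set (plane R) :=
  boundary s `|` inside s.

Definition visible (R : realType) (O : {fset seq (plane R)}) (p q : plane R) :
  Prop := forall s, s \in O -> segment p q `&` region s = set0.

Section VisibilityGraph.
Variables (R : realType) (P : {fset plane R}) (O : {fset seq (plane R)}).

Definition vis_adj : rel P :=
  fun p q => (p != q) && `[< visible O (val p) (val q) >].

Lemma segmentC (p q : plane R) : segment p q = segment q p.
Proof.
suff sub (a b : plane R) : segment a b `<=` segment b a.
  by apply/seteqP; split; apply: sub.
move=> _ [t + <-]; rewrite /= in_itv /= => /andP[t0 t1]; exists (1 - t).
  by rewrite /= in_itv /= subr_ge0 t1 lerBlDr lerDl t0.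
by rewrite opprB addrCA subrr addr0 addrC.
Qed.

Lemma vis_adj_sym : symmetric vis_adj.
Proof.
move=> p q; rewrite /vis_adj eq_sym; congr (_ && _).
by apply: asbool_equiv_eq; split=> h s sO; rewrite segmentC; apply: h.
Qed.

Lemma vis_adj_irr : irreflexive vis_adj.
Proof. by move=> p; rewrite /vis_adj eqxx. Qed.

Definition visibility_graph : sgraph := SGraph vis_adj_sym vis_adj_irr.

End VisibilityGraph.

Definition obstacle_representation (R : realType) (G : sgraph)
    (P : {fset plane R}) (O : {fset seq (plane R)}) : Prop :=
  [/\ forall s, s \in O -> simple_polygon s,
      forall s, s \in O -> [set` P] `&` region s = set0,
      general_position ([set` P] `|` \bigcup_(s in [set` O]) [set` s]) &
      graph_iso (visibility_graph P O) G].

(* Taken in the extended reals, so that no proof that every graph has an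
   obstacle representation is needed: the infimum of a nonempty set of naturals
   is its minimum. *)
Definition obstacle_number (R : realType) (G : sgraph) : \bar R :=
  ereal_inf [set (#|` PO.2|%:R)%:E |
    PO in [set PO : {fset plane R} * {fset seq (plane R)} |
           obstacle_representation G PO.1 PO.2]].

(* inl i is b_i and inr A is r_A; the index set {1, 2, 3, 4} is 'I_4. *)
Definition G3'_vertex : finType := ('I_4 + {A : {set 'I_4} | #|A| == 2})%type.

Definition G3'_adj : rel G3'_vertex := fun u v =>
  match u, v with
  | inl i, inl j => i != j
  | inr A, inr B => A != B
  | inl i, inr A | inr A, inl i => i \in val A
  end.

Lemma G3'_adj_sym : symmetric G3'_adj.
Proof. by move=> [i|A] [j|B] //=; rewrite eq_sym. Qed.

Lemma G3'_adj_irr : irreflexive G3'_adj.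
Proof. by move=> [i|A] /=; rewrite eqxx. Qed.

Definition G3' : sgraph := SGraph G3'_adj_sym G3'_adj_irr.

(* Main.v *)
Require Import Defs.
From mathcomp Require Import all_boot all_order all_algebra finmap.
From mathcomp Require Import all_classical all_reals all_analysis.
From mathcomp Require Import ring lra.

(* The boundary W of a single obstacle is a connected set that avoids every edge
   and meets every nonedge. Hence the interior of a triangle whose sides are
   edges contains all of W or no point of W, and every induced 4-cycle is in
   convex position, since both of its diagonals meet W. On each nonedge choose a
   witness: a point of W, moved slightly along the nonedge into general position
   without changing the clique triangles that contain it. The orientations of
   the triples made of vertices and at most one witness satisfy Knuth's axioms
   of CC systems, each witness is between the ends of its nonedge, and all
   witnesses are in the same clique triangles.

   These constraints are contradictory. If W is inside the blue triangle
   b1 b2 b3, the red vertices r14, r24, r34 give a contradiction; by symmetry W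
   is outside every blue triangle. The four blue points are then either in
   convex position or one of them is in the triangle of the others, and both
   cases are contradictory. Each of the three propositional contradictions is
   certified by a list of clauses, found by a SAT solver, in which every clause
   follows from earlier ones by unit propagation. *)

Set Implicit Arguments.
Unset Strict Implicit.
Unset Printing Implicit Defensive.

Import Order.TTheory GRing.Theory Num.Theory.
Import numFieldNormedType.Exports.

Local Open Scope classical_set_scope.
Local Open Scope ring_scope.

(** * Orientation and triangles *)

(** Twice the signed area of the triangle [p q r], positive when it is counterclockwise. The
    expression is that of [collinear], so general position makes it nonzero. *)
Definition orient (R : realType) (p q r : plane R) : R :=
  (q.1 - p.1) * (r.2 - p.2) - (q.2 - p.2) * (r.1 - p.1).

Definition bary (R : realType) (t : R) (p q : plane R) : plane R :=
  (1 - t) *: p + t *: q.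

Lemma orient_rot (R : realType) (a b c : plane R) :
  orient a b c = orient b c a.
Proof. by rewrite /orient; ring. Qed.

Lemma orient_swap (R : realType) (a b c : plane R) :
  orient b a c = - orient a b c.
Proof. by rewrite /orient; ring. Qed.

Lemma orient_flip (R : realType) (a b c : plane R) :
  orient a c b = - orient a b c.
Proof. by rewrite /orient; ring. Qed.

(** Affine dependence on the last point is what controls orientations along a segment. Rotation
    extends it to the other two arguments. *)
Lemma orient_bary (R : realType) (t : R) (p q a b : plane R) :
  orient a b (bary t p q) = (1 - t) * orient a b p + t * orient a b q.
Proof. by rewrite /orient /bary /=; rewrite /GRing.scale /=; ring. Qed.

Lemma orient_split (R : realType) (a b c x : plane R) :
  orient a b x + orient b c x + orient c a x = orient a b c.
Proof. by rewrite /orient; ring. Qed.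

Lemma orient_continuous (R : realType) (a b : plane R) :
  continuous (orient a b).
Proof.
move=> x; rewrite /orient; apply: cvgB; apply: cvgM; try exact: cvg_cst.
  by apply: cvgB; [exact: cvg_snd | exact: cvg_cst].
by apply: cvgB; [exact: cvg_fst | exact: cvg_cst].
Qed.

Lemma connected_segment (R : realType) (p q : plane R) :
  connected (segment p q).
Proof.
have -> : segment p q = (fun t => bary t p q) @` `[0, 1] by [].
apply: connected_continuous_connected; first exact: segment_connected.
apply: continuous_subspaceT => t; rewrite /bary.
apply: cvgD; apply: cvgZ; try exact: cvg_cst; last exact: cvg_id.
by apply: cvgB; [exact: cvg_cst | exact: cvg_id].
Qed.

Lemma segment_left (R : realType) (p q : plane R) : segment p q p.
Proof.
by exists 0; rewrite ?subr0 ?scale1r ?scale0r ?addr0 //= in_itv /= lexx ler01.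
Qed.

Lemma segment_right (R : realType) (p q : plane R) : segment p q q.
Proof. by rewrite segmentC; exact: segment_left. Qed.

Lemma orientv1 (R : realType) (a b : plane R) : orient a b a = 0.
Proof. by rewrite /orient !subrr !mulr0 subrr. Qed.

Lemma orientv2 (R : realType) (a b : plane R) : orient a b b = 0.
Proof. by rewrite -orient_rot orientv1. Qed.

Lemma open_left (R : realType) (a b : plane R) :
  open [set x | 0 < orient a b x].
Proof.
rewrite (_ : [set x | _] = orient a b @^-1` [set t | 0 < t]) //.
apply: open_comp; last exact: open_gt.
by move=> x _; exact: orient_continuous.
Qed.

Lemma closed_left (R : realType) (a b : plane R) :
  closed [set x | 0 <= orient a b x].
Proof.
rewrite (_ : [set x | _] = orient a b @^-1` [set t | 0 <= t]) //.
apply: closed_comp; last exact: closed_ge.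
by move=> x _; exact: orient_continuous.
Qed.

(** The hypotheses give [W] the same trace on [U] and on [F]. This trace is both open and closed in
    [W] and nonempty, so it is all of [W]. *)
Lemma connected_open_closed (R : realType) (W U F : set (plane R)) x y :
  connected W -> open U -> closed F -> U `<=` F -> W `&` F `<=` U ->
  W x -> U x -> W y -> U y.
Proof.
move=> cW oU cF UF FU Wx Ux Wy.
suff : (W `&` U) y by case.
have -> : W `&` U = W.
  apply: cW; first by exists x.
    by exists U.
  exists F => //; apply/seteqP; split=> z [Wz Uz]; split=> //; first exact: UF.
  exact: FU.
by [].
Qed.

Definition ccw_triangle (R : realType) (a b c x : plane R) : bool :=
  [&& 0 < orient a b x, 0 < orient b c x & 0 < orient c a x].

(** Barycentric coordinates by Cramer's rule, with the denominator cleared. *)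
Lemma orient_barycentric (R : realType) (a b c x : plane R) :
  orient a b c *: x =
  orient b c x *: a + orient c a x *: b + orient a b x *: c.
Proof.
apply: injective_projections; rewrite /= !/(_ *: _) /orient /=; ring.
Qed.

(** The barycentric coordinate of [x] at [c] vanishes, and the other two are nonnegative with sum
    1. *)
Lemma segment_orient0 (R : realType) (a b c x : plane R) :
  0 < orient a b c -> orient a b x = 0 -> 0 <= orient b c x ->
  0 <= orient c a x -> segment a b x.
Proof.
move=> abc abx bcx cax; have := orient_split a b c x; rewrite abx add0r => S.
have D0 : orient a b c != 0 by rewrite gt_eqF.
exists (orient c a x / orient a b c).
  rewrite /= in_itv /= divr_ge0 ?(ltW abc) //=.
  by rewrite ler_pdivrMr // mul1r -S lerDr.
apply: (scalerI D0); rewrite [RHS]orient_barycentric abx scale0r addr0 scalerDr.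
rewrite !scalerA mulrBr mulr1 mulrCA divff // mulr1 -{1}S; congr (_ *: _ + _).
by rewrite addrK.
Qed.

Lemma closed_ccw_triangle (R : realType) (a b c x : plane R) :
  0 < orient a b c ->
  0 <= orient a b x -> 0 <= orient b c x -> 0 <= orient c a x ->
  [\/ ccw_triangle a b c x, segment a b x, segment b c x | segment c a x].
Proof.
move=> abc; rewrite le_eqVlt => /orP[/eqP abx|abx].
  by move=> bcx cax; constructor 2; apply: (@segment_orient0 _ a b c).
rewrite le_eqVlt => /orP[/eqP bcx|bcx].
  move=> cax; constructor 3; apply: (@segment_orient0 _ b c a) => //.
  - by rewrite -orient_rot.
  - exact: ltW.
rewrite le_eqVlt => /orP[/eqP cax|cax].
  constructor 4; apply: (@segment_orient0 _ c a b) => //.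
  - by rewrite orient_rot.
  - exact: ltW.
  - exact: ltW.
by constructor 1; rewrite /ccw_triangle abx bcx.
Qed.

(** As [W] misses the three sides, it has the same points in the open triangle as in the closed one,
    and [connected_open_closed] applies. *)
Lemma connected_ccw_triangle (R : realType) (W : set (plane R))
    (a b c x y : plane R) :
  connected W -> 0 < orient a b c ->
  W `&` segment a b = set0 -> W `&` segment b c = set0 ->
  W `&` segment c a = set0 ->
  W x -> W y -> ccw_triangle a b c x -> ccw_triangle a b c y.
Proof.
move=> cW abc ab bc ca Wx Wy Ux.
pose L p q := [set z : plane R | 0 < orient p q z].
pose C p q := [set z : plane R | 0 <= orient p q z].
suff : (L a b `&` (L b c `&` L c a)) y by case=> ? [? ?]; apply/and3P.
apply: (@connected_open_closed _ W _ (C a b `&` (C b c `&` C c a)) x) => //.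
- by apply: openI; [|apply: openI]; exact: open_left.
- by apply: closedI; [|apply: closedI]; exact: closed_left.
- by move=> z [/ltW ? [/ltW ? /ltW ?]].
- move=> z [Wz [Cab [Cbc Cca]]].
  have [/and3P[//]|S|S|S] := closed_ccw_triangle abc Cab Cbc Cca.
  + have : (W `&` segment a b) z by [].
    by rewrite ab.
  + have : (W `&` segment b c) z by [].
    by rewrite bc.
  + have : (W `&` segment c a) z by [].
    by rewrite ca.
- by case/and3P: Ux.
Qed.

(* The four sides bound the reflex quadrilateral a b c d, whose diagonal bd lies
   inside it while ac lies outside: W cannot meet both diagonals. *)
Lemma connected_reflex_quadrilateral (R : realType) (W : set (plane R))
    (a b c d x y : plane R) :
  connected W -> 0 < orient a c d -> ccw_triangle a c d b ->
  W `&` segment a b = set0 -> W `&` segment b c = set0 ->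
  W `&` segment c d = set0 -> W `&` segment d a = set0 ->
  W x -> segment b d x -> W y -> segment a c y -> False.
Proof.
move=> cW acd Tb ab bc cd da Wx bdx Wy acy.
have disj p q z : W `&` segment p q = set0 -> W z -> segment p q z -> False.
  by move=> E Wz S; have : (W `&` segment p q) z by []; rewrite E.
pose L p q := [set z : plane R | 0 < orient p q z].
pose C p q := [set z : plane R | 0 <= orient p q z].
case/and3P: Tb => acb cdb dab.
have abc : 0 < orient a c b by [].
have [t tP bdxE] := bdx; have [s sP acyE] := acy.
(* This open set is the interior of the quadrilateral: the open triangle [a c d] without the closed
   triangle [a c b]. It contains [x], but [y] lies on the line [a c] and cannot be in it. *)
suff : ((L a c `&` (L c d `&` L d a)) `&` (L a b `|` L b c)) y.
  move=> [[yac _] _]; move: yac; rewrite /L /= -acyE -/(bary s a c) orient_bary.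
  by rewrite orientv1 orientv2 !mulr0 addr0 ltxx.
apply: (@connected_open_closed _ W _
    ((C a c `&` (C c d `&` C d a)) `&` (C a b `|` C b c)) x) => //.
- apply: openI; first by apply: openI; [|apply: openI]; exact: open_left.
  by apply: openU; exact: open_left.
- apply: closedI.
    by apply: closedI; [|apply: closedI]; exact: closed_left.
  by apply: closedU; exact: closed_left.
- move=> z [[/ltW ? [/ltW ? /ltW ?]] []/ltW ?]; split=> //; [left|right] => //.
- move=> z [Wz [[Cac [Ccd Cda]] CC]].
  have [/and3P[Uac Ucd Uda]|S|S|S] := closed_ccw_triangle acd Cac Ccd Cda.
  + split=> //; have [?|abz] := ltP 0 (orient a b z); first by left.
    have [?|bcz] := ltP 0 (orient b c z); first by right.
    have acz : 0 <= orient a c z by exact: ltW.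
    exfalso; case: CC => CC.
      apply: (disj a b z) => //; rewrite segmentC.
      apply: (@segment_orient0 _ b a c) => //; first by rewrite orient_rot.
        by apply/eqP; rewrite orient_swap oppr_eq0 eq_le abz.
      by rewrite orient_swap oppr_ge0.
    apply: (disj b c z) => //; rewrite segmentC.
    apply: (@segment_orient0 _ c b a) => //; first by rewrite -orient_rot.
      by apply/eqP; rewrite orient_swap oppr_eq0 eq_le bcz.
    by rewrite orient_swap oppr_ge0.
  (* On the side [a c] only the two ends satisfy the closed condition [C a b] or [C b c]. They
     belong to the sides [a b] and [b c], which [W] misses. *)
  + exfalso; have [u] := S; rewrite /= in_itv /= => /andP[u0 u1] uz.
    have abcN : orient a b c < 0.
      by rewrite -(orient_rot c) orient_swap oppr_lt0.
    case: CC; rewrite /C /= -uz -/(bary u a c) orient_bary.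
      rewrite orientv1 mulr0.
      rewrite add0r nmulr_lge0 // => u0'.
      have u00 : u = 0 by apply/eqP; rewrite eq_le u0 u0'.
      apply: (disj a b z) => //; rewrite -uz u00 subr0 scale1r scale0r addr0.
      exact: segment_left.
    rewrite orientv2 mulr0 addr0 -orient_rot nmulr_lge0 // subr_le0 => u1'.
    have u11 : u = 1 by apply/eqP; rewrite eq_le u1 u1'.
    apply: (disj b c z) => //; rewrite -uz u11 subrr scale1r scale0r add0r.
    exact: segment_right.
  + by case: (disj _ _ _ cd Wz S).
  + by case: (disj _ _ _ da Wz S).
(* It remains to put [x] in the interior. It is neither [b] nor [d], as these are ends of sides
   missed by [W], so it is strictly between them. *)
- move: tP; rewrite /= in_itv /= => /andP[t0 t1].
  have {}t0 : 0 < t.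
    rewrite lt_neqAle t0 andbT; apply/eqP => t00; apply: (disj a b x) => //.
    by rewrite -bdxE -t00 subr0 scale1r scale0r addr0; exact: segment_right.
  have {}t1 : 0 < 1 - t.
    rewrite subr_gt0 lt_neqAle t1 andbT; apply/eqP => t11.
    apply: (disj c d x) => //.
    by rewrite -bdxE t11 subrr scale1r scale0r add0r; exact: segment_right.
  have dab' : 0 < orient a b d by rewrite -orient_rot.
  have acx : 0 < orient a c x.
    by rewrite -bdxE -/(bary t b d) orient_bary addr_gt0 ?mulr_gt0.
  have cdx : 0 < orient c d x.
    by rewrite -bdxE -/(bary t b d) orient_bary orientv2 mulr0 addr0 mulr_gt0.
  have dax : 0 < orient d a x.
    by rewrite -bdxE -/(bary t b d) orient_bary orientv1 mulr0 addr0 mulr_gt0.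
  have abx : 0 < orient a b x.
    by rewrite -bdxE -/(bary t b d) orient_bary orientv2 mulr0 add0r mulr_gt0.
  by split; [|left].
Qed.

(** * The boundary of a polygon *)

Lemma nth_iter_next (T : eqType) (x : T) (p : seq T) (k : nat) :
  uniq (x :: p) -> (k < size (x :: p))%N ->
  nth x (x :: p) k = iter k (next (x :: p)) x.
Proof.
move=> U; elim: k => [//|k IH] kp; rewrite iterS -IH; last exact: ltnW.
by rewrite next_nth mem_nth ?(ltnW kp) // index_uniq // ltnW.
Qed.

(** The sides are added one by one in cyclic order, each starting at the vertex where the previous
    one ends. Simplicity plays no part beyond distinct vertices. *)
Lemma connected_boundary (R : realType) (s : seq (plane R)) :
  uniq s -> connected (boundary s).
Proof.
case: s => [|x p] U.
  have -> : @boundary R [::] = set0 by apply/seteqP; split=> z //= [].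
  exact: connected0.
set s := x :: p.
pose v k := iter k (next s) x.
have vs k : v k \in s.
  by elim: k => [|k IH]; [exact: mem_head | rewrite /v iterS mem_next].
pose A n := \bigcup_(k in [set k | (k <= n)%N]) side s (v k).
have cA n : connected (A n).
  elim: n => [|n IH].
    have -> : A 0%N = side s (v 0%N).
      apply/seteqP; split=> z; last by exists 0%N.
      by case=> k /=; rewrite leqn0 => /eqP ->.
    exact: connected_segment.
  have -> : A n.+1 = A n `|` side s (v n.+1).
    apply/seteqP; split=> z.
      case=> k /=; rewrite leq_eqVlt => /orP[/eqP ->|kn] zk; first by right.
      by left; exists k.
    case=> [[k /= kn zk]|zk]; last by exists n.+1 => /=.
    by exists k => //=; exact: leqW.
  apply: connectedU => //; [|exact: connected_segment].
  exists (v n.+1); split; last exact: segment_left.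
  by exists n => /=; [|exact: segment_right].
suff -> : boundary s = A (size s) by exact: cA.
apply/seteqP; split=> z; last by case=> k _ kz; exists (v k); first exact: vs.
case=> w /= ws wz; exists (index w s); first exact: index_size.
by rewrite /v -nth_iter_next // ?index_mem // nth_index.
Qed.

(** A segment that avoids the boundary stays in one component of its complement. If it had a point
    in the inside, then [p] would be in the same bounded component. This allows the obstacle to be
    replaced by its boundary, which is connected. *)
Lemma segment_region_boundary (R : realType) (s : seq (plane R))
    (p q : plane R) :
  ~ region s p -> segment p q `&` region s !=set0 ->
  segment p q `&` boundary s !=set0.
Proof.
move=> ps [x [px [bx|[nbx ix]]]]; first by exists x.
apply: contrapT => /set0P/negP/negPn/eqP E.
apply: ps; right.
have sub : segment p q `<=` ~` boundary s.
  by move=> z pz bz; have : (segment p q `&` boundary s) z by []; rewrite E.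
split; first by apply: sub; exact: segment_left.
have xp : connected_component (~` boundary s) x p.
  exists (segment p q); last exact: segment_left.
  by split=> //; exact: connected_segment.
by rewrite -(same_connected_component xp).
Qed.

(** * Drawings and witnesses *)

(* The codes 0 to 3 stand for b_1 to b_4, and the codes 4 to 9 for the red
   vertices r_A, with A listed in red_ends shifted by one. *)
Definition red_ends : seq (nat * nat) :=
  [:: (0, 1); (0, 2); (0, 3); (1, 2); (1, 3); (2, 3)]%N.

Definition sees (i k : nat) : bool :=
  let e := nth (0, 0)%N red_ends k in (i == e.1) || (i == e.2).

Definition edge (i j : nat) : bool :=
  (i != j) && match (i < 4)%N, (j < 4)%N with
              | true, false => sees i (j - 4)
              | false, true => sees j (i - 4)
              | _, _ => true
              end.

Definition nonedges : seq (nat * nat) :=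
  [seq e <- [seq (i, j) | i <- iota 0 10, j <- iota 0 10] |
     (e.1 < e.2)%N && ~~ edge e.1 e.2].

Lemma edgeC (i j : nat) : edge i j = edge j i.
Proof. by rewrite /edge eq_sym; case: (i < 4)%N; case: (j < 4)%N. Qed.

(** All that is retained of a representation with one obstacle: [W] will be the boundary of the
    obstacle and [f] the placement of the ten coded vertices. *)
Record drawing (R : realType) (W : set (plane R)) (f : nat -> plane R) : Prop :=
  Drawing {
  drawing_connected : connected W ;
  drawing_generic : forall i j k, (i < 10)%N -> (j < 10)%N -> (k < 10)%N ->
    i != j -> j != k -> i != k -> orient (f i) (f j) (f k) != 0 ;
  drawing_edge : forall i j, (i < 10)%N -> (j < 10)%N -> edge i j ->
    W `&` segment (f i) (f j) = set0 ;
  drawing_nonedge : forall i j, (i < 10)%N -> (j < 10)%N -> i != j ->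
    ~~ edge i j -> W `&` segment (f i) (f j) !=set0 }.

(** A pair stands for the affine function with these values at 0 and 1. A function that is not
    identically zero has at most one zero, so just after [t] it is nonzero, and by continuity it
    keeps any nonzero sign that it has at [t]. *)
Lemma affine_perturbation (R : realType) (L : seq (R * R)) (t : R) :
  (forall h, h \in L -> (h.1 != 0) || (h.2 != 0)) ->
  exists2 d, 0 < d & forall u, t < u -> u < t + d -> forall h, h \in L ->
    (1 - u) * h.1 + u * h.2 != 0 /\
    0 <= ((1 - t) * h.1 + t * h.2) * ((1 - u) * h.1 + u * h.2).
Proof.
elim: L => [|[a b] L IH] H; first by exists 1.
have {IH}[d d0 IH] : exists2 d, 0 < d & forall u, t < u -> u < t + d ->
    forall h, h \in L -> (1 - u) * h.1 + u * h.2 != 0 /\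
    0 <= ((1 - t) * h.1 + t * h.2) * ((1 - u) * h.1 + u * h.2).
  by apply: IH => h hL; apply: H; rewrite inE hL orbT.
suff [d' d'0 P] : exists2 d', 0 < d' & forall u, t < u -> u < t + d' ->
    (1 - u) * a + u * b != 0 /\
    0 <= ((1 - t) * a + t * b) * ((1 - u) * a + u * b).
  exists (Num.min d d'); first by rewrite lt_min d0.
  move=> u tu; rewrite -ltrBlDl lt_min => /andP[ud ud'] h.
  rewrite inE => /orP[/eqP -> /=|hL]; first by apply: P; rewrite // -ltrBlDl.
  by apply: IH => //; rewrite -ltrBlDl.
have /= ab := H _ (mem_head _ _).
set v := (1 - t) * a + t * b.
have vE u : (1 - u) * a + u * b = v + (u - t) * (b - a) by rewrite /v; ring.
(* If the function vanishes at [t], its slope is nonzero and every larger [u] works. *)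
have [v0|v0] := eqVneq v 0.
  exists 1 => // u tu _; rewrite vE v0 mul0r lexx; split=> //.
  rewrite add0r mulf_neq0 ?subr_eq0 ?(gt_eqF tu) //.
  apply/eqP => E; move: v0 ab; rewrite /v -E => v0.
  have -> : b = 0 by rewrite -v0; ring.
  by rewrite orbb eqxx.
(* Adding 1 keeps the denominator positive when the slope is zero. Within the radius
   [|v| / (|b - a| + 1)] the change is smaller than [|v|]. *)
have D0 : 0 < `|b - a| + 1 by rewrite ltr_wpDl.
exists (`|v| / (`|b - a| + 1)) => [|u tu]; first by rewrite divr_gt0 ?normr_gt0.
rewrite -ltrBlDl ltr_pdivlMr // => uv.
have {uv} : `|(u - t) * (b - a)| < `|v|.
  apply: le_lt_trans uv; rewrite normrM gtr0_norm ?subr_gt0 //.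
  by rewrite ler_wpM2l ?subr_ge0 ?(ltW tu) // lerDl.
rewrite vE; move: (_ * (b - a)) => w; clearbody v.
case: (ltgtP v 0) v0 => // v0 _; rewrite ltr_norml.
  rewrite ltr0_norm // opprK => /andP[_ wv].
  have vw : v + w < 0 by rewrite -ltrBrDl sub0r.
  by rewrite lt_eqF // nmulr_rge0 ?ltW.
rewrite gtr0_norm // => /andP[wv _].
have vw : 0 < v + w by rewrite -ltrBlDl sub0r.
by rewrite gt_eqF // mulr_ge0 ?ltW.
Qed.

(** Three positive areas would add up to [orient a c b], which is negative. *)
Lemma ccw_triangle_swap (R : realType) (a b c x : plane R) :
  0 < orient a b c -> ~~ ccw_triangle a c b x.
Proof.
move=> abc; apply/negP => /and3P[acx cbx bax].
suff : 0 < orient a c b by rewrite orient_rot orient_swap oppr_gt0 orient_rot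
  orient_rot ltNge ltW.
rewrite -(orient_split a c b x); exact: (addr_gt0 (addr_gt0 acx cbx) bax).
Qed.

(** Every vertex is the end of some edge, and [W] misses that edge. *)
Lemma drawing_vertex (R : realType) (W : set (plane R)) (f : nat -> plane R) i :
  drawing W f -> (i < 10)%N -> ~ W (f i).
Proof.
move=> D i10 Wi.
have /hasP[j] : has (edge i) (iota 0 10).
  by apply: (allP (_ : all (fun i => has (edge i) (iota 0 10)) (iota 0 10)));
     rewrite ?mem_iota.
rewrite mem_iota /= => j10 ij; have E := drawing_edge D i10 j10 ij.
have : (W `&` segment (f i) (f j)) (f i) by split=> //; exact: segment_left.
by rewrite E.
Qed.

(* The point of W on a nonedge pq can be moved along pq off all the lines
   through two other vertices without changing the triangles containing it. *)
Lemma drawing_witness (R : realType) (W : set (plane R)) (f : nat -> plane R)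
    (p q : nat) :
  drawing W f -> (p < 10)%N -> (q < 10)%N -> p != q -> ~~ edge p q ->
  exists w : plane R, [/\ exists2 t, 0 < t < 1 & w = bary t (f p) (f q),
    forall i j, (i < 10)%N -> (j < 10)%N -> i != j ->
      ~~ (i \in [:: p; q]) || ~~ (j \in [:: p; q]) ->
      orient (f i) (f j) w != 0 &
    forall i j k, (i < 10)%N -> (j < 10)%N -> (k < 10)%N ->
      edge i j -> edge j k -> edge k i -> 0 < orient (f i) (f j) (f k) ->
      (ccw_triangle (f i) (f j) (f k) w <->
       exists2 x, W x & ccw_triangle (f i) (f j) (f k) x)].
Proof.
move=> D p10 q10 pq npq.
have [x0 [Wx0 [t tP x0E]]] := drawing_nonedge D p10 q10 pq npq.
have {x0E}x0E : x0 = bary t (f p) (f q) by [].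
have t0 : 0 < t.
  move: tP; rewrite /= in_itv /= lt_neqAle => /andP[-> _]; rewrite andbT.
  apply/eqP => t00; apply: (drawing_vertex D p10).
  by rewrite -[f p](_ : x0 = _) // x0E /bary -t00 subr0 scale1r scale0r addr0.
have t1 : t < 1.
  move: tP; rewrite /= in_itv /= (lt_neqAle t) => /andP[_ ->]; rewrite andbT.
  apply/eqP => t11; apply: (drawing_vertex D q10).
  by rewrite -[f q](_ : x0 = _) // x0E /bary t11 subrr scale1r scale0r add0r.
pose far i j := ~~ (i \in [:: p; q]) || ~~ (j \in [:: p; q]).
pose S := [seq e <- [seq (i, j) | i <- iota 0 10, j <- iota 0 10] |
             (e.1 != e.2) && far e.1 e.2].
(* The side of a line on which a point moving along [pq] lies is given by an affine function,
   recorded here by its values at [p] and [q]. At least one value is nonzero, since an end of [pq]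
   is off the line. *)
pose h e := (orient (f e.1) (f e.2) (f p), orient (f e.1) (f e.2) (f q)).
have hS i j : (i < 10)%N -> (j < 10)%N -> i != j -> far i j ->
    h (i, j) \in map h S.
  move=> i10 j10 ij ijS; apply: map_f.
  rewrite mem_filter; apply/andP; split; first exact/andP.
  by apply/allpairsPdep; exists i, j; rewrite !mem_iota.
have hL l : l \in map h S -> (l.1 != 0) || (l.2 != 0).
  case/mapP => -[i j]; rewrite mem_filter => /andP[ijS].
  move=> /allpairsPdep[i' [j' [i10 j10 [? ?]]]] ->; subst i' j'.
  move: i10 j10; rewrite !mem_iota => i10 j10.
  case/andP: ijS => /= ij ijS.
  have [ip|ip] := eqVneq i p.
    have iq : i != q by rewrite ip.
    rewrite (drawing_generic D i10 j10 q10) ?orbT //.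
    by apply/eqP => jq; move: ijS; rewrite /far ip jq !inE !eqxx ?orbT.
  have [jp|jp] := eqVneq j p; last by rewrite (drawing_generic D i10 j10 p10).
  rewrite (drawing_generic D i10 j10 q10) ?orbT //; first by rewrite jp.
  by apply/eqP => iq; move: ijS; rewrite /far jp iq !inE !eqxx ?orbT.
have [d d0 P] := affine_perturbation t hL.
have [u [tu ud u1]] : exists u, [/\ t < u, u < t + d & u < 1].
  exists (t + Num.min d (1 - t) / 2).
  have m0 : 0 < Num.min d (1 - t) by rewrite lt_min d0 subr_gt0.
  have m2 : Num.min d (1 - t) / 2 < Num.min d (1 - t).
    by rewrite ltr_pdivrMr // mulr_natr mulr2n ltrDl.
  rewrite ltrDl divr_gt0 // ltrD2l -ltrBrDl; split=> //.
    by apply: (lt_le_trans m2); rewrite ge_min lexx.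
  by apply: (lt_le_trans m2); rewrite ge_min lexx orbT.
have {}P i j : (i < 10)%N -> (j < 10)%N -> i != j -> far i j ->
    orient (f i) (f j) (bary u (f p) (f q)) != 0 /\
    0 <= orient (f i) (f j) x0 * orient (f i) (f j) (bary u (f p) (f q)).
  move=> i10 j10 ij ijS; rewrite x0E !orient_bary.
  exact: (P u tu ud _ (hS _ _ i10 j10 ij ijS)).
exists (bary u (f p) (f q)); split.
- by exists u; rewrite ?u1 ?(lt_trans t0).
- by move=> i j i10 j10 ij ijS; case: (P i j).
move=> i j k i10 j10 k10 eij ejk eki ijk.
(* The nonedge [pq] is not an edge, so the perturbation controls the lines of all triangle sides. *)
have far_edge a b : edge a b -> a != b /\ far a b.
  move=> ab; have aDb : a != b by case/andP: ab.
  split=> //; rewrite /far -negb_and; apply/negP; rewrite !inE.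
  case/andP => /orP[]/eqP ae /orP[]/eqP be; move: aDb ab;
    rewrite ae be ?eqxx //.
    by rewrite (negPf npq).
  by rewrite edgeC (negPf npq).
have Q a b : (a < 10)%N -> (b < 10)%N -> edge a b ->
    orient (f a) (f b) (bary u (f p) (f q)) != 0 /\
    0 <= orient (f a) (f b) x0 * orient (f a) (f b) (bary u (f p) (f q)).
  by move=> a10 b10 /far_edge[? ?]; exact: P.
have same a b : (a < 10)%N -> (b < 10)%N -> edge a b ->
    0 < orient (f a) (f b) x0 -> 0 < orient (f a) (f b) (bary u (f p) (f q)).
  move=> a10 b10 /Q[] // n0 s abx; rewrite lt_neqAle eq_sym n0 /=.
  by move: s; rewrite pmulr_rge0.
have back a b : (a < 10)%N -> (b < 10)%N -> edge a b ->
    0 < orient (f a) (f b) (bary u (f p) (f q)) -> 0 <= orient (f a) (f b) x0.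
  by move=> a10 b10 /Q[] // _ s abx; move: s; rewrite pmulr_lge0.
have avoid a b : (a < 10)%N -> (b < 10)%N -> edge a b ->
    ~ segment (f a) (f b) x0.
  move=> a10 b10 ab abx; have : (W `&` segment (f a) (f b)) x0 by [].
  by rewrite (drawing_edge D).
(* If the moved point is inside the triangle, then [x0] is in the closed triangle, and off its sides
   because it is in [W]. Conversely, a point of [W] inside puts [x0] inside by connectedness, and
   the perturbation keeps the signs. *)
split=> [/and3P[uij ujk uki]|[x Wx Tx]].
  exists x0 => //.
  by have [//|/avoid|/avoid|/avoid] := closed_ccw_triangle ijk
    (back _ _ i10 j10 eij uij) (back _ _ j10 k10 ejk ujk)
    (back _ _ k10 i10 eki uki); case.
have /and3P[xij xjk xki] : ccw_triangle (f i) (f j) (f k) x0.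
  by apply: (connected_ccw_triangle (drawing_connected D) ijk _ _ _ Wx Wx0 Tx);
    exact: (drawing_edge D).
by apply/and3P; split; apply: same.
Qed.

(** * Propositional refutations *)

Definition nonedge_of (c : nat) : nat * nat := nth (0, 0)%N nonedges (c - 10).

(** Sorting the ends makes the code independent of their order. There are twelve nonedges, so the
    codes run from 10 to 21. *)
Definition witness (p q : nat) : nat :=
  (10 + index (minn p q, maxn p q) nonedges)%N.

(** A witness is off every line through two vertices except the line of its own nonedge. A triple
    containing two witnesses never qualifies. *)
Definition generic_line (a b c : nat) : bool :=
  [&& (a < 10)%N, (b < 10)%N, a != b &
      if (c < 10)%N then (c != a) && (c != b)
      else (c < 22)%N &&
        let e := nonedge_of c in
        ~~ (a \in [:: e.1; e.2]) || ~~ (b \in [:: e.1; e.2])].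

Definition generic (a b c : nat) : bool :=
  [|| generic_line a b c, generic_line b c a | generic_line c a b].

Definition meets_triangle (R : realType) (W : set (plane R))
    (f : nat -> plane R) (i j k : nat) : Prop :=
  exists2 x, W x &
    ccw_triangle (f i) (f j) (f k) x \/ ccw_triangle (f i) (f k) (f j) x.

(* The code 10 + k stands for a witness on the k-th nonedge. *)
Record extension (R : realType) (W : set (plane R)) (f g : nat -> plane R) :
  Prop := Extension {
  extension_vertex : forall i, (i < 10)%N -> g i = f i ;
  extension_generic : forall a b c, generic a b c ->
    orient (g a) (g b) (g c) != 0 ;
  extension_witness : forall p q, (p < 10)%N -> (q < 10)%N -> p != q ->
    ~~ edge p q ->
    exists2 t, 0 < t < 1 & g (witness p q) = bary t (g p) (g q) ;
  extension_triangle : forall i j k c, (i < 10)%N -> (j < 10)%N ->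
    (k < 10)%N -> edge i j -> edge j k -> edge k i -> (10 <= c < 22)%N ->
    0 < orient (g i) (g j) (g k) ->
    ccw_triangle (g i) (g j) (g k) (g c) <-> meets_triangle W f i j k }.

Lemma drawing_extension (R : realType) (W : set (plane R))
    (f : nat -> plane R) :
  drawing W f -> exists g, extension W f g.
Proof.
move=> D.
have ne c : (10 <= c < 22)%N -> let e := nonedge_of c in
    [/\ (e.1 < 10)%N, (e.2 < 10)%N, e.1 != e.2 & ~~ edge e.1 e.2].
  move=> c22 e.
  suff : [&& (e.1 < 10)%N, (e.2 < 10)%N, e.1 != e.2 & ~~ edge e.1 e.2].
    by case/and4P.
  apply: (allP (_ : all (fun c => let e := nonedge_of c in
    [&& (e.1 < 10)%N, (e.2 < 10)%N, e.1 != e.2 & ~~ edge e.1 e.2])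
    (iota 10 12))).
    by [].
  by rewrite mem_iota.
have /choice[w wP] : forall c, exists w : plane R, (10 <= c < 22)%N ->
    let e := nonedge_of c in
  [/\ exists2 t, 0 < t < 1 & w = bary t (f e.1) (f e.2),
    forall i j, (i < 10)%N -> (j < 10)%N -> i != j ->
      ~~ (i \in [:: e.1; e.2]) || ~~ (j \in [:: e.1; e.2]) ->
      orient (f i) (f j) w != 0 &
    forall i j k, (i < 10)%N -> (j < 10)%N -> (k < 10)%N ->
      edge i j -> edge j k -> edge k i -> 0 < orient (f i) (f j) (f k) ->
      (ccw_triangle (f i) (f j) (f k) w <->
       exists2 x, W x & ccw_triangle (f i) (f j) (f k) x)].
  (* A number that codes no witness gets an arbitrary point. *)
  move=> c; have [cc|_] := boolP (10 <= c < 22)%N; last by exists (f 0%N).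
  have [e1 e2 e12 ee] := ne c cc.
  by have [w wP] := drawing_witness D e1 e2 e12 ee; exists w.
pose g c := if (c < 10)%N then f c else w c.
have gf i : (i < 10)%N -> g i = f i by rewrite /g => ->.
have gw c : (10 <= c < 22)%N -> g c = w c.
  by case/andP=> c10 _; rewrite /g ltnNge c10.
have line a b c : generic_line a b c -> orient (g a) (g b) (g c) != 0.
  case/and4P => a10 b10 ab; case: ifP => c10.
    case/andP => ca cb; rewrite !gf //.
    by apply: (drawing_generic D); rewrite // eq_sym.
  case/andP => c22 far; have cc : (10 <= c < 22)%N by rewrite leqNgt c10.
  by rewrite (gw _ cc) !gf //; have [_ H _] := wP c cc; exact: H.
exists g; split=> //.
- move=> a b c /or3P[/line|/line|/line] //; first by rewrite -orient_rot.
  by rewrite orient_rot.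
- move=> p q p10 q10 pq npq.
  have : (10 <= witness p q < 22)%N /\
      (nonedge_of (witness p q) = (p, q) \/ nonedge_of (witness p q) = (q, p)).
    have : [|| p == q, edge p q | (10 <= witness p q < 22)%N &&
      ((nonedge_of (witness p q) == (p, q)) ||
       (nonedge_of (witness p q) == (q, p)))].
      have H : all (fun p => all (fun q =>
        [|| p == q, edge p q | (10 <= witness p q < 22)%N &&
        ((nonedge_of (witness p q) == (p, q)) ||
         (nonedge_of (witness p q) == (q, p)))]) (iota 0 10))
        (iota 0 10) by vm_compute.
      apply: (allP (allP H p _) q); by rewrite mem_iota.
    rewrite (negPf pq) (negPf npq) !orFb => /andP[-> /orP[]/eqP ->]; split=> //.
      by left.
    by right.
  case=> cc E; rewrite (gw _ cc) !gf //.
  have [[t t01 ->] _ _] := wP _ cc; case: E => -> /=; first by exists t.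
  (* Here the nonedge is listed as [(q, p)], and the parameter is reversed. *)
  exists (1 - t); last by rewrite /bary subKr addrC.
  by case/andP: t01 => t0 t1; rewrite subr_gt0 t1 gtrBl.
move=> i j k c i10 j10 k10 ij jk ki cc; rewrite (gw _ cc) !gf // => ijk.
have [_ _ /(_ i j k i10 j10 k10 ij jk ki ijk) [H1 H2]] := wP c cc; split.
  by case/H1 => x Wx Tx; exists x => //; left.
case=> x Wx Tx; apply: H2; exists x => //; case: Tx => // Tx.
by case/negP: (ccw_triangle_swap x ijk).
Qed.

Inductive literal :=
  | Ccw of nat & nat & nat
  | Hit of nat & nat & nat
  | Miss of nat & nat & nat.

Definition clause := seq literal.

(** The smallest code is rotated to the front, so that the three rotations of a triple of distinct
    codes become one literal and can be compared syntactically. *)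
Definition ccw (a b c : nat) : literal :=
  if (a < b)%N && (a < c)%N then Ccw a b c
  else if (b < c)%N && (b < a)%N then Ccw b c a else Ccw c a b.

(** Reversing an orientation negates it only for a triple that is not collinear, which
    [generic_literal] guarantees. The first code stays in front. *)
Definition negate (l : literal) : literal :=
  match l with
  | Ccw a b c => Ccw a c b
  | Hit i j k => Miss i j k
  | Miss i j k => Hit i j k
  end.

Definition same_literal (l m : literal) : bool :=
  match l, m with
  | Ccw a b c, Ccw a' b' c' | Hit a b c, Hit a' b' c'
  | Miss a b c, Miss a' b' c' => [&& a == a', b == b' & c == c']
  | _, _ => false
  end.

Definition generic_literal (l : literal) : bool :=
  if l is Ccw a b c then generic a b c else true.

Definition sorted_triple (T : Type) (F : nat -> nat -> nat -> T)
    (i j k : nat) : T :=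
  if (i < j)%N then
    if (j < k)%N then F i j k else if (i < k)%N then F i k j else F k i j
  else
    if (i < k)%N then F j i k else if (j < k)%N then F j k i else F k j i.

(* Interior and Transitive are Knuth's axioms 4 and 5 of CC systems. *)
Inductive rule :=
  | Interior of nat & nat & nat & nat
  | Transitive of nat & nat & nat & nat & nat
  | Before of nat & nat & nat
  | After of nat & nat & nat
  | Inside of nat & nat & nat & nat
  | Outside of nat & nat & nat & nat
  | Reflex of nat & nat & nat & nat.

Definition clique (i j k : nat) : bool :=
  [&& (i < 10)%N, (j < 10)%N, (k < 10)%N, edge i j, edge j k & edge k i].

Definition nonadjacent (i j : nat) : bool :=
  [&& (i < 10)%N, (j < 10)%N, i != j & ~~ edge i j].

Definition side_condition (r : rule) : bool :=
  match r with
  | Before p q _ | After p q _ => nonadjacent p q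
  | Inside i j k c | Outside i j k c => clique i j k && (10 <= c < 22)%N
  | Reflex a b c d => [&& nonadjacent a c, nonadjacent b d,
      edge a b, edge b c, edge c d & edge d a]
  | _ => true
  end.

(** Each clause is an implication whose premises are written negated. The conclusion is the last
    literal, except that it is the first one in [Outside], and that [Reflex] has none. *)
Definition rule_clause (r : rule) : clause :=
  match r with
  | Interior p q r t =>
    [:: ccw t r q; ccw p r t; ccw p t q; ccw p q r]
  | Transitive t s p q r =>
    [:: ccw t p s; ccw t q s; ccw t r s; ccw t q p; ccw t r q; ccw t p r]
  | Before p q x => [:: ccw p x q; ccw p (witness p q) x]
  | After p q x => [:: ccw p x q; ccw (witness p q) q x]
  | Inside i j k c =>
    [:: sorted_triple Miss i j k; ccw i k j; ccw i j c]
  | Outside i j k c =>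
    [:: sorted_triple Hit i j k; ccw i k j; ccw i c j; ccw j c k; ccw k c i]
  | Reflex a b c d => [:: ccw a d c; ccw a b c; ccw c b d; ccw d b a]
  end.

Definition satisfied (R : realType) (W : set (plane R)) (f g : nat -> plane R)
    (l : literal) : Prop :=
  match l with
  | Ccw a b c => 0 < orient (g a) (g b) (g c)
  | Hit i j k => meets_triangle W f i j k
  | Miss i j k => ~ meets_triangle W f i j k
  end.

Fixpoint holds (R : realType) (W : set (plane R)) (f g : nat -> plane R)
    (c : clause) : Prop :=
  if c is l :: c' then satisfied W f g l \/ holds W f g c' else False.

(** Unit propagation in a prescribed order. [A] collects the literals known to be true; each clause
    must reduce to one new literal, until one becomes empty. *)
Fixpoint propagates (cs : seq clause) (A : seq literal) : bool :=
  if cs is c :: cs' then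
    match [seq l <- c | ~~ has (same_literal (negate l)) A] with
    | [::] => true
    | [:: l] => propagates cs' (l :: A)
    | _ => false
    end
  else false.

(* The hints of a step are the positions, in the list of the hypotheses, the
   rules and the previous steps, of the clauses used in unit propagation. *)
Fixpoint refutes (cs : seq clause) (steps : seq (clause * seq nat)) : bool :=
  if steps is (c, hints) :: steps' then
    [&& all generic_literal c,
        propagates (pmap (onth cs) hints) (map negate c) &
        nilp c || refutes (rcons cs c) steps']
  else false.

Definition refutation (hyps : clause) (rules : seq rule)
    (steps : seq (clause * seq nat)) : bool :=
  all side_condition rules &&
  all (all generic_literal) (map rule_clause rules) &&
  refutes ([seq [:: l] | l <- hyps] ++ map rule_clause rules) steps.

(** * Soundness of the rules and of unit propagation *)

Section Soundness.
Variables (R : realType) (W : set (plane R)) (f g : nat -> plane R).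
Hypotheses (D : drawing W f) (E : extension W f g).

Lemma same_literalE l m : same_literal l m -> l = m.
Proof.
by case: l m => [a b c|a b c|a b c] [a' b' c'|a' b' c'|a' b' c'] //=;
   case/and3P => /eqP -> /eqP -> /eqP ->.
Qed.

Lemma satisfied_ccw a b c :
  satisfied W f g (ccw a b c) <-> 0 < orient (g a) (g b) (g c).
Proof.
rewrite /ccw; case: ifP => _ //=; case: ifP => _ /=.
  by rewrite -orient_rot.
by rewrite orient_rot.
Qed.

Lemma satisfied_negate_ccw a b c :
  satisfied W f g (negate (ccw a b c)) <-> 0 < orient (g a) (g c) (g b).
Proof.
rewrite /ccw; case: ifP => _ //=; case: ifP => _ /=.
  by rewrite orient_rot.
by rewrite -orient_rot.
Qed.

Lemma satisfied_negate l : satisfied W f g (negate l) -> ~ satisfied W f g l.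
Proof.
case: l => [a b c|a b c|a b c] //=; last by move=> m; apply.
by rewrite orient_flip oppr_gt0 => /ltW; rewrite leNgt => /negP.
Qed.

Lemma negate_generic l :
  generic_literal l -> ~ satisfied W f g l -> satisfied W f g (negate l).
Proof.
case: l => [a b c|a b c|a b c] //=; last by move=> _ /contrapT.
move=> /(extension_generic E) n0 /negP; rewrite -leNgt => le0.
by rewrite orient_flip oppr_gt0 lt_neqAle n0.
Qed.

Lemma meets_triangle_sorted i j k :
  sorted_triple (meets_triangle W f) i j k <-> meets_triangle W f i j k.
Proof.
have rot a b c : meets_triangle W f a b c -> meets_triangle W f b c a.
  move=> [x Wx H]; exists x => //.
  by case: H => /and3P[? ? ?]; [left|right]; apply/and3P.
have swap a b c : meets_triangle W f a b c -> meets_triangle W f a c b.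
  by move=> [x Wx H]; exists x => //; case: H; [right|left].
by rewrite /sorted_triple; case: ifP => _; case: ifP => _; try case: ifP => _;
  split; auto 6.
Qed.

Lemma satisfied_Hit i j k :
  satisfied W f g (sorted_triple Hit i j k) <-> meets_triangle W f i j k.
Proof.
by rewrite -meets_triangle_sorted /sorted_triple; do 3?case: ifP => _.
Qed.

Lemma satisfied_Miss i j k :
  satisfied W f g (sorted_triple Miss i j k) <-> ~ meets_triangle W f i j k.
Proof.
by rewrite -meets_triangle_sorted /sorted_triple; do 3?case: ifP => _.
Qed.

(** Reads a clause as an implication, with the negation of its first literal as premise. *)
Lemma holds_cons l c : generic_literal l ->
  (satisfied W f g (negate l) -> holds W f g c) -> holds W f g (l :: c).
Proof.
move=> gl H; have [?|nl] := pselect (satisfied W f g l); first by left.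
by right; apply: H; exact: negate_generic.
Qed.

Lemma rule_sound r : side_condition r ->
  all generic_literal (rule_clause r) -> holds W f g (rule_clause r).
Proof.
have seg p q : nonadjacent p q ->
    exists2 t, 0 < t < 1 & g (witness p q) = bary t (g p) (g q).
  by case/and4P => *; exact: (extension_witness E).
have cl0 l : holds W f g [:: l] <-> satisfied W f g l by split=> [[]|] //; left.
case: r; rewrite /rule_clause.
- move=> p q r t _ G; case/and4P: (G) => g1 g2 g3 _.
  apply: (holds_cons g1) => /satisfied_negate_ccw tqr.
  apply: (holds_cons g2) => /satisfied_negate_ccw ptr.
  apply: (holds_cons g3) => /satisfied_negate_ccw pqt.
  apply/cl0/satisfied_ccw.
  (* The areas of the three triangles with apex [t] add up to that of [p q r]. *)
  have -> : orient (g p) (g q) (g r) = orient (g t) (g q) (g r) +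
      orient (g p) (g t) (g r) + orient (g p) (g q) (g t).
    by rewrite /orient; ring.
  exact: addr_gt0 (addr_gt0 tqr ptr) pqt.
- move=> t s p q r _ G; case/and5P: (G) => g1 g2 g3 g4 /andP[g5 _].
  apply: (holds_cons g1) => /satisfied_negate_ccw tsp.
  apply: (holds_cons g2) => /satisfied_negate_ccw tsq.
  apply: (holds_cons g3) => /satisfied_negate_ccw tsr.
  apply: (holds_cons g4) => /satisfied_negate_ccw tpq.
  apply: (holds_cons g5) => /satisfied_negate_ccw tqr.
  apply/cl0/satisfied_ccw; rewrite -(pmulr_rgt0 _ tsq).
  (* This is the three-term Grassmann-Plücker relation. All factors other than
     [orient (g t) (g p) (g r)] are positive. *)
  have -> : orient (g t) (g s) (g q) * orient (g t) (g p) (g r) =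
      orient (g t) (g s) (g p) * orient (g t) (g q) (g r) +
      orient (g t) (g s) (g r) * orient (g t) (g p) (g q).
    by rewrite /orient; ring.
  exact: addr_gt0 (mulr_gt0 tsp tqr) (mulr_gt0 tsr tpq).
- move=> p q x /seg[t /andP[t0 t1] w] G; case/andP: (G) => g1 _.
  apply: (holds_cons g1) => /satisfied_negate_ccw pqx.
  (* The contribution of the end [p] vanishes, so the orientation with the witness is [t] times that
     with [q]. For [After] the factor is [1 - t]. *)
  apply/cl0/satisfied_ccw; rewrite w -orient_rot orient_bary.
  by rewrite orientv2 mulr0 add0r mulr_gt0 // orient_rot.
- move=> p q x /seg[t /andP[t0 t1] w] G; case/andP: (G) => g1 _.
  apply: (holds_cons g1) => /satisfied_negate_ccw pqx.
  apply/cl0/satisfied_ccw; rewrite w orient_rot orient_bary.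
  rewrite orientv1 mulr0 addr0; apply: mulr_gt0; first by rewrite subr_gt0.
  by rewrite -orient_rot.
- move=> i j k c /andP[/and5P[i10 j10 k10 ij /andP[jk ki]] cc] G.
  case/and3P: (G) => g1 g2 _.
  apply: (holds_cons g1) => M.
  apply: (holds_cons g2) => /satisfied_negate_ccw ijk.
  apply/cl0/satisfied_ccw.
  have : meets_triangle W f i j k.
    apply: contrapT => /satisfied_Miss H; exact: (satisfied_negate M).
  by case/(extension_triangle E i10 j10 k10 ij jk ki cc ijk)/and3P.
- move=> i j k c /andP[/and5P[i10 j10 k10 ij /andP[jk ki]] cc].
  move=> G; case/and5P: (G) => g1 g2 g3 g4 /andP[g5 _].
  apply: (holds_cons g1) => M.
  apply: (holds_cons g2) => /satisfied_negate_ccw ijk.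
  apply: (holds_cons g3) => /satisfied_negate_ccw ijc.
  apply: (holds_cons g4) => /satisfied_negate_ccw jkc.
  apply: (holds_cons g5) => /satisfied_negate_ccw kic.
  apply: (satisfied_negate M); apply/satisfied_Hit.
  by apply/(extension_triangle E i10 j10 k10 ij jk ki cc ijk)/and3P.
- move=> a b c d /and5P[/and4P[a10 c10 ac nac] /and4P[b10 d10 bd nbd]].
  move=> ab bc /andP[cd da].
  move=> G; case/and5P: (G) => g1 g2 g3 g4 _.
  apply: (holds_cons g1) => /satisfied_negate_ccw acd.
  apply: (holds_cons g2) => /satisfied_negate_ccw acb.
  apply: (holds_cons g3) => /satisfied_negate_ccw cdb.
  apply: (holds_cons g4) => /satisfied_negate_ccw dab.
  rewrite !(extension_vertex E) // in acd acb cdb dab.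
  (* Both diagonals are nonedges and so meet [W], while the four sides are edges. *)
  have [x [Wx bdx]] := drawing_nonedge D b10 d10 bd nbd.
  have [y [Wy acy]] := drawing_nonedge D a10 c10 ac nac.
  apply: (connected_reflex_quadrilateral (drawing_connected D) acd _ _ _ _ _
    Wx bdx Wy acy); try exact: (drawing_edge D).
  exact/and3P.
Qed.

Lemma propagates_sound cs A : propagates cs A ->
  List.Forall (holds W f g) cs -> List.Forall (satisfied W f g) A -> False.
Proof.
elim: cs A => [//|c cs IH] A /= P; case/List.Forall_cons_iff => Hc Hcs HA.
(* A literal is deleted only if its negation is in [A], so a true literal of the clause survives. *)
have : holds W f g [seq l <- c | ~~ has (same_literal (negate l)) A].
  elim: c Hc {P} => [//|l c IHc] /= [sl|/IHc ?]; last by case: ifP => //; right.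
  case: ifP => [_|/negbFE hA]; first by left.
  exfalso; elim: A HA hA {IH IHc} => [//|m A IH] /=.
  case/List.Forall_cons_iff => sm sA /orP[/same_literalE lm|]; last exact: IH.
  by rewrite -lm in sm; case: (satisfied_negate sm).
case: [seq l <- c | _] P => [//|l [|//]] /IH H [|//] sl.
by apply: H => //; constructor.
Qed.

Lemma Forall_onth (T : Type) (P : T -> Prop) (s : seq T) (hints : seq nat) :
  List.Forall P s -> List.Forall P (pmap (onth s) hints).
Proof.
move=> Ps; elim: hints => [|n hints IH] /=; first by constructor.
have Pn x : onth s n = Some x -> P x.
  elim: s n Ps {IH} => [|y s IH] [|n] //= /List.Forall_cons_iff[Py Ps].
    by case=> <-.
  exact: IH.
by case: (onth s n) Pn => //= x Px; constructor=> //; exact: Px.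
Qed.

(** Each step is reverse unit propagation: if its clause failed, the negations of all its literals
    would hold, by genericity, and propagation from them ends in a contradiction. The last clause is
    empty and hence absurd. *)
Lemma refutes_sound cs steps : refutes cs steps ->
  List.Forall (holds W f g) cs -> False.
Proof.
elim: steps cs => [//|[c hints] steps IH] cs /= /and3P[gc P Q] Hcs.
have Hc : holds W f g c.
  apply: contrapT => nc; apply: (propagates_sound P); first exact: Forall_onth.
  elim: c gc nc {P Q} => [|l c IHc] /=; first by constructor.
  case/andP => gl gc nlc; constructor.
    by apply: negate_generic => // ?; apply: nlc; left.
  by apply: IHc => // ?; apply: nlc; right.
case: c Q Hc {gc P} => [//|l c] /= /IH H Hc; apply: H.
by rewrite -cats1; apply/List.Forall_app; split=> //; constructor.
Qed.

Lemma refutation_sound hyps rules steps : refutation hyps rules steps ->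
  List.Forall (satisfied W f g) hyps -> False.
Proof.
case/andP => /andP[side gen] ref Hh; apply: (refutes_sound ref).
apply/List.Forall_app; split.
  by elim: hyps Hh {ref} => [|l hyps IH] /=; first (by constructor);
     case/List.Forall_cons_iff => sl sh; constructor; [left|exact: IH].
elim: rules side gen {ref} => [|r rules IH] /=; first by constructor.
case/andP => sr srs /andP[gr grs]; constructor; last exact: IH.
exact: rule_sound.
Qed.

End Soundness.

(** * The certificates of the three contradictions *)

Definition enclosed_rules : seq rule :=
  [:: After 0 8 6; After 0 9 2; After 1 6 0; After 1 6 3; After 1 9 0;
   After 1 9 3; After 1 9 6; After 1 9 8; After 2 6 1; After 2 6 3;
   After 2 6 8; After 2 6 9; After 2 8 1; After 6 1 0; After 6 1 3;
   After 6 2 3; After 8 0 2; After 8 2 1; After 9 0 2; After 9 1 3;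
   After 9 1 8; Before 0 8 1; Before 0 9 1; Before 0 9 3; Before 1 6 2;
   Before 1 6 3; Before 1 9 2; Before 1 9 8; Before 2 6 0; Before 2 8 3;
   Before 6 1 2; Before 6 1 3; Before 6 2 0; Before 8 0 1; Before 8 2 0;
   Before 8 2 3; Before 9 0 1; Before 9 1 2; Before 9 1 6; Before 9 1 8;
   Inside 0 1 2 11; Inside 0 1 2 12; Inside 0 1 2 14; Inside 0 1 2 17;
   Inside 0 1 2 18; Inside 0 3 2 12; Inside 0 3 2 15; Inside 0 6 3 14;
   Inside 1 2 0 11; Inside 1 2 0 14; Inside 1 2 0 15; Inside 1 2 0 18;
   Inside 1 3 0 17; Inside 1 3 0 18; Inside 1 8 3 18; Inside 2 0 1 11;
   Inside 2 0 1 12; Inside 2 0 1 14; Inside 2 0 1 15; Inside 2 0 1 17;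
   Inside 2 3 1 11; Inside 2 3 1 12; Inside 2 3 1 18; Inside 2 9 3 12;
   Inside 3 0 1 17; Inside 3 0 1 18; Inside 3 1 2 11; Inside 3 1 2 15;
   Inside 3 2 0 15; Inside 6 0 3 17; Inside 6 8 3 11; Inside 6 8 3 14;
   Inside 8 1 3 11; Inside 8 9 3 15; Inside 8 9 3 18; Inside 9 2 3 15;
   Inside 9 6 3 12; Inside 9 6 3 17; Interior 0 1 3 14; Interior 0 2 6 3;
   Interior 0 2 14 3; Interior 0 3 6 14; Interior 1 2 3 6; Interior 1 3 8 18;
   Interior 1 3 11 8; Interior 2 3 9 12; Interior 2 3 14 6;
   Interior 3 8 9 15; Outside 0 1 3 14; Outside 0 3 2 14; Outside 0 3 6 14;
   Outside 0 3 6 15; Outside 0 6 3 17; Outside 0 6 3 18; Outside 1 2 3 14;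
   Outside 1 3 8 17; Outside 1 3 8 18; Outside 1 8 3 11; Outside 1 8 3 15;
   Outside 2 3 9 11; Outside 2 9 3 14; Outside 2 9 3 15; Outside 3 6 8 17;
   Outside 3 8 9 11; Outside 3 8 9 15; Outside 3 9 6 15;
   Transitive 0 1 3 6 17; Transitive 0 1 3 8 18; Transitive 1 2 0 3 9;
   Transitive 1 2 3 6 8; Transitive 1 2 3 8 11; Transitive 1 2 3 9 6;
   Transitive 1 2 8 11 9; Transitive 1 3 6 8 17; Transitive 1 3 6 18 8;
   Transitive 1 6 0 3 9; Transitive 2 0 1 3 6; Transitive 2 0 1 3 9;
   Transitive 2 0 1 3 15; Transitive 2 0 3 9 15; Transitive 2 0 6 9 15;
   Transitive 2 0 6 14 9; Transitive 2 8 1 3 6; Transitive 3 0 2 8 6;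
   Transitive 3 0 2 8 17; Transitive 3 1 8 11 9; Transitive 3 2 0 1 6;
   Transitive 3 2 1 6 9; Transitive 3 2 1 6 15; Transitive 3 6 1 2 18;
   Transitive 3 9 0 1 14; Transitive 3 15 0 1 6; Transitive 3 17 1 2 8;
   Transitive 6 3 0 14 2; Transitive 6 8 0 14 2; Transitive 8 3 0 1 18;
   Transitive 8 9 1 18 3; Transitive 8 11 1 9 3; Transitive 9 3 1 2 12;
   Transitive 9 6 1 2 12; Transitive 9 11 1 2 3; Transitive 14 3 0 1 2;
   Transitive 15 2 0 6 9; Transitive 18 6 0 1 3].

Definition enclosed_steps : seq (clause * seq nat) :=
  [:: ([:: Ccw 3 8 11; Ccw 1 3 11], [:: 0; 1; 42; 53; 23; 19; 35; 14; 86; 99;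
   56]); ([:: Ccw 1 15 8; Ccw 1 3 15; Ccw 3 9 15; Ccw 1 3 8; Ccw 3 18 8],
   [:: 0; 1; 53; 19; 14; 56; 29; 100; 41; 89; 106; 138; 76]); ([:: Ccw 2 3 9;
   Ccw 2 12 3; Ccw 1 3 9], [:: 0; 1; 58; 43; 52; 20; 24; 28; 3; 38; 87;
   140]); ([:: Ccw 3 11 9; Hit 2 3 9; Ccw 2 11 3; Ccw 2 9 3; Ccw 1 11 9;
   Ccw 1 3 9], [:: 0; 1; 52; 28; 101; 142]); ([:: Ccw 0 14 3; Ccw 3 14 6],
   [:: 0; 1; 61; 44; 30; 15; 34; 4; 83; 71; 92]); ([:: Ccw 1 8 6; Ccw 1 6 3;
   Ccw 1 18 3; Ccw 1 17 3; Ccw 1 3 2; Ccw 2 17 3], [:: 0; 1; 42; 51; 53; 23;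
   26; 19; 35; 10; 14; 111; 115; 74; 97; 98; 134; 37]); ([:: Ccw 3 18 8;
   Ccw 1 18 3], [:: 0; 1; 42; 53; 23; 19; 35; 14; 85; 98; 74]); ([:: Miss 1 2
   3; Ccw 1 3 2; Hit 2 3 9], [:: 0; 1; 42; 50; 52; 53; 23; 28; 19; 35; 69;
   63; 64; 68; 62; 21; 31; 146; 112; 7; 148; 37; 147; 22; 9; 114; 149; 127;
   139; 75; 105]); ([:: Ccw 1 3 2; Ccw 1 3 14; Hit 2 3 9], [:: 0; 1; 61; 60;
   59; 58; 43; 44; 51; 52; 30; 20; 24; 15; 26; 28; 34; 6; 4; 32; 39; 16; 5;
   153; 96; 143; 88; 82; 135; 91; 71; 70; 47; 48; 121; 103; 25; 7; 21; 113;
   110; 40; 133; 132; 93; 102; 144; 123; 122]); ([:: Ccw 1 3 14; Hit 2 3 9],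
   [:: 0; 1; 61; 60; 58; 43; 44; 51; 52; 30; 20; 24; 15; 26; 28; 3; 38; 4;
   32; 39; 16; 5; 154; 84; 135; 81; 128; 119; 120; 103; 7; 21; 129; 117; 130;
   8; 107; 79; 78; 13; 141]); ([:: Ccw 1 2 3; Ccw 0 3 17; Ccw 2 3 8; Ccw 0 3
   8; Ccw 0 3 6; Ccw 3 17 6], [:: 0; 1; 61; 44; 51; 53; 30; 15; 26; 19; 4;
   32; 11; 17; 118; 124; 126; 125; 12; 104; 73; 72; 136; 2]); ([:: Ccw 1 14
   3], [:: 0; 1; 57; 42; 61; 44; 45; 53; 46; 18; 23; 30; 15; 19; 36; 34; 4;
   14; 27; 33; 150; 80; 90; 67; 66; 54; 55; 109; 108; 152; 137; 49; 37; 94;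
   31; 11; 17; 156; 151; 131; 116; 95; 145]); ([::], [:: 0; 1; 58; 52; 20;
   28; 3; 39; 157; 155; 77; 65])].

Definition convex_rules : seq rule :=
  [:: After 0 8 1; After 0 8 3; After 1 5 0; After 1 5 2; After 2 8 1;
   After 2 8 3; After 3 5 0; After 3 5 1; After 3 5 2; After 5 1 8;
   After 5 3 0; After 5 3 2; After 5 3 8; After 8 0 1; After 8 0 3;
   After 8 0 5; After 8 2 0; After 8 2 1; After 8 2 3; After 8 2 5;
   Before 0 8 1; Before 0 8 2; Before 0 8 3; Before 0 8 5; Before 1 5 3;
   Before 1 5 8; Before 2 8 0; Before 2 8 1; Before 2 8 3; Before 2 8 5;
   Before 3 5 0; Before 3 5 1; Before 3 5 2; Before 3 5 8; Before 5 1 0;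
   Before 5 1 2; Before 5 3 0; Before 5 3 2; Before 5 3 8; Before 8 0 1;
   Before 8 0 3; Before 8 2 0; Before 8 2 1; Before 8 2 3; Inside 0 5 2 11;
   Inside 0 5 2 13; Inside 1 3 8 13; Inside 1 8 3 11; Inside 1 8 3 13;
   Inside 2 5 0 13; Inside 2 5 0 18; Inside 3 1 8 20; Inside 3 8 1 11;
   Inside 3 8 1 18; Inside 3 8 1 20; Inside 5 0 2 11; Inside 5 0 2 13;
   Inside 5 2 0 13; Inside 5 2 0 18; Inside 8 1 3 11; Inside 8 1 3 13;
   Inside 8 1 3 18; Inside 8 3 1 11; Inside 8 3 1 20; Interior 0 1 8 2;
   Interior 0 1 8 3; Interior 0 1 11 3; Interior 0 2 5 3; Interior 0 2 20 3;
   Interior 0 2 20 5; Interior 0 3 5 8; Interior 0 3 8 5; Interior 1 2 18 3;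
   Interior 1 3 11 8; Interior 2 3 8 5; Outside 0 1 3 11; Outside 0 2 3 18;
   Outside 0 2 3 20; Outside 0 2 5 20; Outside 0 5 2 20; Outside 1 2 3 18;
   Outside 1 3 8 11; Outside 1 3 8 18; Outside 1 8 3 11; Outside 1 8 3 18;
   Reflex 0 1 8 5; Reflex 0 3 8 5; Reflex 0 5 8 3; Reflex 1 8 5 0;
   Reflex 1 8 5 2; Reflex 2 3 8 5; Reflex 2 5 8 1; Reflex 3 0 5 8;
   Reflex 5 0 3 8; Reflex 5 2 3 8; Reflex 5 8 1 0; Reflex 5 8 1 2;
   Reflex 5 8 3 0; Reflex 8 1 2 5; Reflex 8 3 0 5; Reflex 8 5 0 1;
   Reflex 8 5 2 3; Transitive 0 1 2 3 8; Transitive 0 1 2 3 18;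
   Transitive 0 8 1 3 5; Transitive 0 8 1 3 18; Transitive 0 8 2 3 5;
   Transitive 0 11 1 2 5; Transitive 1 2 0 8 3; Transitive 1 5 0 8 2;
   Transitive 1 8 0 5 3; Transitive 2 3 0 1 8; Transitive 2 8 0 5 3;
   Transitive 3 0 1 2 8; Transitive 3 0 1 2 18; Transitive 3 0 2 5 8;
   Transitive 3 5 0 2 8; Transitive 3 8 0 1 18; Transitive 3 8 1 2 5;
   Transitive 5 0 1 2 8; Transitive 5 0 1 8 3; Transitive 5 2 1 20 8;
   Transitive 5 3 0 2 8; Transitive 5 20 0 8 2; Transitive 8 0 1 2 3;
   Transitive 8 0 1 3 2; Transitive 8 0 2 5 3].

Definition convex_steps : seq (clause * seq nat) :=
  [:: ([:: Ccw 0 18 3; Ccw 0 2 18; Ccw 0 18 8; Ccw 0 3 8; Ccw 0 1 8], [:: 4;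
   5; 6; 110; 112]); ([:: Ccw 2 3 8; Ccw 0 3 8; Ccw 0 3 18; Ccw 1 8 11; Ccw 1
   18 8], [:: 3; 4; 5; 12; 35; 120; 121; 54; 91]); ([:: Ccw 1 8 2; Ccw 0 1 8;
   Ccw 0 3 8], [:: 0; 3; 4; 5; 6; 8; 11; 34; 115; 59; 120; 25; 50; 87; 89]);
   ([:: Ccw 0 8 3; Ccw 1 8 11], [:: 3; 5; 46; 27; 21; 47; 72; 73; 88; 68; 67;
   53; 60; 61; 49; 16; 31; 12; 40; 14; 125; 45; 108; 15; 128; 98]);
   ([:: Ccw 3 5 8; Ccw 0 5 3; Ccw 0 3 8], [:: 78; 93]); ([:: Ccw 0 5 3; Ccw 0
   3 8; Ccw 0 1 8], [:: 4; 5; 6; 136; 71; 138; 99; 113; 111; 92; 116; 105;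
   126]); ([:: Ccw 0 3 8; Ccw 1 11 8], [:: 2; 5; 7; 20; 8; 29; 82; 80; 90;
   55; 70; 58; 32; 19; 38; 117; 107; 127; 94]); ([:: Ccw 1 2 8; Ccw 2 3 8;
   Ccw 0 8 3; Ccw 0 8 1], [:: 3; 4; 5; 6; 47; 109; 12; 35; 24; 49; 132; 79;
   91; 69]); ([:: Ccw 3 8 5; Ccw 0 3 5; Ccw 0 8 3], [:: 106; 77]); ([:: Ccw 2
   3 5; Ccw 0 5 3; Ccw 0 8 1; Ccw 1 8 2], [:: 4; 13; 37; 18; 44; 74; 75; 85;
   63; 56; 57; 62; 41; 10; 36; 22; 95; 103]); ([:: Ccw 2 3 5; Ccw 2 8 3;
   Ccw 0 3 8; Ccw 0 2 11; Ccw 0 1 8], [:: 4; 6; 27; 136; 139; 43; 44; 122;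
   101; 45; 104; 130; 30; 114; 92; 116; 105]); ([:: Ccw 0 3 8], [:: 1; 4; 6;
   140; 46; 136; 139; 71; 49; 17; 43; 23; 28; 48; 134; 135; 144; 15; 39; 84;
   76; 86; 64; 65; 52; 51; 42; 26; 9; 30; 96; 102]); ([:: Ccw 2 8 3], [:: 1;
   3; 4; 5; 6; 145; 137; 7; 109; 33; 25; 50; 118; 131; 83; 124; 11; 66; 89]);
   ([:: Ccw 0 3 5], [:: 4; 5; 6; 145; 137; 7; 109; 146; 142; 100; 133; 97;
   119; 129]); ([::], [:: 4; 145; 137; 7; 146; 141; 147; 143; 123; 81; 97])].

Definition nonconvex_rules : seq rule :=
  [:: After 0 7 1; After 0 7 2; After 0 7 3; After 1 5 0; After 1 5 2;
   After 1 5 4; After 1 5 7; After 2 4 0; After 2 4 1; After 2 4 5;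
   After 2 4 7; After 2 8 0; After 2 8 3; After 3 4 0; After 3 4 1;
   After 3 4 7; After 3 5 0; After 3 5 2; After 3 5 7; After 3 7 0;
   After 3 7 1; After 3 7 2; After 3 7 5; After 4 2 0; After 4 2 1;
   After 4 2 5; After 4 2 7; After 4 3 0; After 4 3 1; After 5 1 0;
   After 5 1 2; After 5 1 7; After 5 3 0; After 5 3 2; After 5 3 7;
   After 6 2 7; After 7 0 1; After 7 0 2; After 7 3 1; After 7 3 2;
   After 8 0 1; After 8 0 5; After 8 2 1; After 8 2 7; Before 0 7 1;
   Before 0 7 2; Before 0 7 3; Before 0 7 5; Before 0 8 2; Before 1 5 0;
   Before 1 5 2; Before 1 5 4; Before 1 5 7; Before 1 5 8; Before 1 6 7;
   Before 2 4 0; Before 2 4 1; Before 2 4 5; Before 2 4 7; Before 2 6 1;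
   Before 2 8 5; Before 3 4 0; Before 3 4 1; Before 3 4 2; Before 3 5 0;
   Before 3 5 1; Before 3 5 2; Before 3 7 0; Before 3 7 1; Before 3 7 2;
   Before 3 7 5; Before 4 2 0; Before 4 2 1; Before 4 2 7; Before 4 3 0;
   Before 4 3 1; Before 5 1 0; Before 5 1 2; Before 5 1 3; Before 5 1 7;
   Before 5 3 0; Before 5 3 1; Before 5 3 2; Before 5 3 7; Before 7 0 1;
   Before 7 0 2; Before 7 0 3; Before 7 0 4; Before 7 0 5; Before 7 3 1;
   Before 7 3 2; Before 7 3 5; Before 8 2 5; Inside 0 2 5 10;
   Inside 0 2 5 11; Inside 0 4 1 10; Inside 0 4 1 16; Inside 0 4 1 19;
   Inside 0 4 1 20; Inside 0 5 2 10; Inside 0 5 2 13; Inside 0 5 2 20;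
   Inside 0 5 4 20; Inside 0 5 4 21; Inside 1 0 4 11; Inside 1 0 4 18;
   Inside 1 0 4 20; Inside 1 2 7 13; Inside 1 2 7 16; Inside 1 4 0 13;
   Inside 1 4 0 16; Inside 1 7 2 10; Inside 1 7 2 13; Inside 1 7 2 14;
   Inside 1 7 4 13; Inside 2 0 5 10; Inside 2 0 5 16; Inside 2 1 7 13;
   Inside 2 1 7 17; Inside 2 5 0 13; Inside 2 5 0 18; Inside 2 5 0 20;
   Inside 2 5 7 16; Inside 2 5 7 18; Inside 2 5 7 20; Inside 2 7 1 10;
   Inside 2 7 1 16; Inside 2 7 1 21; Inside 2 7 5 10; Inside 4 0 5 19;
   Inside 4 0 5 21; Inside 4 1 0 16; Inside 4 1 0 18; Inside 4 5 7 13;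
   Inside 5 0 2 11; Inside 5 0 2 13; Inside 5 2 0 16; Inside 5 2 7 20;
   Inside 7 1 2 10; Inside 7 1 2 13; Inside 7 1 4 21; Inside 7 2 1 10;
   Inside 7 2 1 17; Inside 7 2 5 16; Inside 7 2 5 18; Inside 7 4 5 10;
   Inside 7 5 2 21; Interior 0 1 2 3; Interior 0 1 5 2; Interior 0 1 5 7;
   Interior 0 1 7 2; Interior 0 1 13 2; Interior 0 1 16 2; Interior 0 1 16 4;
   Interior 0 1 19 3; Interior 0 1 21 3; Interior 0 2 3 5; Interior 0 2 3 7;
   Interior 0 2 3 20; Interior 0 2 4 7; Interior 0 2 5 13; Interior 0 2 7 5;
   Interior 0 3 7 5; Interior 0 4 13 5; Interior 1 2 4 7; Interior 1 2 5 4;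
   Interior 1 2 7 3; Interior 1 2 7 4; Interior 1 2 7 13; Interior 1 2 7 16;
   Interior 1 2 10 7; Interior 1 2 16 7; Interior 1 2 21 3;
   Interior 1 2 21 7; Interior 1 3 10 7; Interior 1 4 7 16;
   Interior 1 4 16 7; Interior 2 4 7 5; Interior 2 5 16 7; Interior 4 5 7 16;
   Outside 0 1 2 10; Outside 0 1 2 13; Outside 0 1 2 16; Outside 0 1 3 10;
   Outside 0 1 3 19; Outside 0 1 4 16; Outside 0 1 4 19; Outside 0 2 5 13;
   Outside 0 2 5 20; Outside 0 3 2 20; Outside 0 3 2 21; Outside 0 4 1 13;
   Outside 0 4 1 16; Outside 0 4 1 19; Outside 0 5 2 13; Outside 0 5 2 20;
   Outside 0 5 4 13; Outside 1 2 3 19; Outside 1 2 3 20; Outside 1 2 3 21;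
   Outside 1 2 7 13; Outside 1 2 7 16; Outside 1 2 7 21; Outside 1 4 7 16;
   Outside 1 4 7 19; Outside 1 7 2 10; Outside 1 7 2 16; Outside 1 7 2 21;
   Outside 1 7 4 16; Outside 2 5 7 13; Outside 2 7 5 16; Outside 2 7 5 20;
   Outside 2 7 5 21; Outside 4 5 7 16; Reflex 0 1 7 5; Reflex 0 4 7 2;
   Reflex 0 5 7 1; Reflex 0 5 8 1; Reflex 1 2 5 4; Reflex 1 4 5 2;
   Reflex 1 7 5 0; Reflex 2 0 4 7; Reflex 2 1 4 5; Reflex 2 3 8 7;
   Reflex 2 7 4 0; Reflex 3 6 7 2; Reflex 3 8 5 0; Reflex 4 0 2 7;
   Reflex 4 1 2 5; Reflex 4 5 2 1; Reflex 5 0 1 7; Reflex 5 4 1 2;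
   Reflex 5 7 1 0; Reflex 5 8 1 0; Reflex 5 8 1 2; Reflex 5 8 3 0;
   Reflex 5 8 3 2; Reflex 7 1 0 5; Reflex 7 2 0 4; Reflex 7 5 0 1;
   Reflex 7 6 3 1; Reflex 8 1 2 5; Reflex 8 3 2 5; Transitive 0 1 2 4 3;
   Transitive 0 1 2 5 3; Transitive 0 1 2 7 3; Transitive 0 1 2 21 7;
   Transitive 0 1 3 5 7; Transitive 0 4 1 2 10; Transitive 0 4 1 3 20;
   Transitive 0 5 1 2 7; Transitive 0 5 1 3 8; Transitive 0 5 1 3 21;
   Transitive 0 5 1 21 4; Transitive 0 7 1 2 4; Transitive 0 7 1 2 5;
   Transitive 0 7 1 3 5; Transitive 0 21 1 3 4; Transitive 1 0 4 7 18;
   Transitive 1 2 0 4 7; Transitive 1 2 0 5 3; Transitive 1 2 0 5 4;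
   Transitive 1 2 0 5 8; Transitive 1 2 0 7 3; Transitive 1 2 0 13 3;
   Transitive 1 2 3 4 7; Transitive 1 2 3 13 8; Transitive 1 2 4 5 7;
   Transitive 1 4 0 5 2; Transitive 1 4 2 3 5; Transitive 1 4 2 5 7;
   Transitive 1 4 2 7 19; Transitive 1 5 0 4 2; Transitive 1 5 2 3 4;
   Transitive 1 5 2 3 7; Transitive 1 5 2 7 4; Transitive 1 7 0 5 3;
   Transitive 1 7 0 5 21; Transitive 1 7 0 13 2; Transitive 1 7 2 3 6;
   Transitive 1 18 2 4 7; Transitive 2 0 1 4 3; Transitive 2 0 1 5 3;
   Transitive 2 0 1 7 3; Transitive 2 0 1 7 5; Transitive 2 1 4 5 7;
   Transitive 2 3 1 5 7; Transitive 2 3 1 20 7; Transitive 2 4 0 1 7;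
   Transitive 2 4 1 5 7; Transitive 2 5 0 3 8; Transitive 2 5 1 8 7;
   Transitive 2 7 0 1 4; Transitive 2 7 0 3 5; Transitive 2 7 1 4 3;
   Transitive 2 16 1 5 7; Transitive 3 0 1 5 7; Transitive 3 1 2 7 5;
   Transitive 3 2 0 5 7; Transitive 3 4 0 1 2; Transitive 3 5 0 1 2;
   Transitive 3 5 0 1 7; Transitive 3 5 0 7 2; Transitive 3 5 2 7 4;
   Transitive 3 7 0 1 2; Transitive 3 7 1 2 5; Transitive 3 7 1 2 8;
   Transitive 3 7 1 2 20; Transitive 3 20 0 1 2; Transitive 4 1 0 5 16;
   Transitive 4 2 0 1 7; Transitive 4 2 3 5 7; Transitive 4 5 1 2 7;
   Transitive 5 0 1 7 20; Transitive 5 1 0 7 3; Transitive 5 1 0 21 7;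
   Transitive 5 2 0 4 1; Transitive 5 2 1 4 7; Transitive 5 7 2 3 4;
   Transitive 5 13 0 3 2; Transitive 5 13 0 3 7; Transitive 6 3 1 7 2;
   Transitive 7 0 1 2 4; Transitive 7 0 1 4 2; Transitive 7 0 2 5 4;
   Transitive 7 1 0 5 3; Transitive 7 1 2 3 5; Transitive 7 2 0 4 1;
   Transitive 7 3 1 5 2; Transitive 7 10 1 2 3; Transitive 7 10 1 4 3;
   Transitive 7 10 2 5 3; Transitive 8 3 0 18 5; Transitive 21 0 2 5 3].

Definition nonconvex_steps : seq (clause * seq nat) :=
  [:: ([:: Ccw 1 3 21; Ccw 0 1 7], [:: 3; 0; 1; 2; 154; 7; 75; 96; 270; 118;
   157; 290; 28; 76; 214; 206]); ([:: Ccw 1 7 3; Ccw 2 3 7; Ccw 1 10 7],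
   [:: 1; 46; 97; 27; 75; 173; 179; 209; 145]); ([:: Ccw 0 5 3; Ccw 5 7 13;
   Ccw 0 13 5; Ccw 0 7 5; Ccw 0 7 3; Ccw 1 5 3; Ccw 1 3 7], [:: 2; 85; 327;
   308]); ([:: Ccw 1 3 7; Ccw 2 21 3; Ccw 2 7 21; Ccw 1 13 7; Ccw 0 7 1;
   Ccw 0 1 13], [:: 3; 0; 1; 2; 154; 45; 96; 206; 180; 214; 285; 124]);
   ([:: Ccw 0 4 2; Ccw 2 7 4; Ccw 0 1 4; Ccw 0 1 7; Ccw 0 2 7], [:: 0; 1; 2;
   154; 228; 261]); ([:: Ccw 0 2 7; Ccw 0 1 13; Ccw 0 7 1; Ccw 1 3 7], [:: 6;
   0; 1; 2; 154; 43; 91; 8; 52; 187; 177; 290; 212; 28; 76; 119; 344]);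
   ([:: Ccw 2 7 3; Ccw 3 10 7; Ccw 1 3 7; Ccw 1 10 7; Ccw 2 10 7], [:: 3; 1;
   45; 96; 28; 76; 336; 206; 148; 214]); ([:: Ccw 0 5 7; Ccw 0 7 1; Ccw 0 1
   5], [:: 156; 237]); ([:: Ccw 1 3 7; Ccw 0 7 1; Ccw 1 5 7; Ccw 0 1 5; Ccw 2
   20 3], [:: 0; 1; 2; 36; 40; 24; 346; 283; 44; 72; 307; 315; 87; 163; 165;
   202; 122]); ([:: Ccw 0 7 1; Ccw 2 20 3; Ccw 0 1 5], [:: 5; 0; 1; 2; 43;
   91; 348; 244; 349; 342; 311; 9; 53; 181; 190]); ([:: Ccw 0 5 7; Ccw 0 3 7;
   Ccw 0 2 7; Ccw 0 1 5; Ccw 2 20 3; Ccw 2 5 20], [:: 0; 1; 2; 154; 350; 54;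
   263; 262; 39; 87; 106; 165; 202]); ([:: Ccw 2 3 7; Ccw 1 21 3; Ccw 2 7
   10], [:: 1; 45; 27; 46; 97; 173; 179; 209; 132]); ([:: Ccw 0 1 8; Ccw 0 1
   5; Ccw 1 5 2; Ccw 0 8 5; Ccw 0 3 5; Ccw 1 13 3; Ccw 2 8 5; Ccw 2 3 5;
   Ccw 2 7 8; Ccw 2 7 3; Ccw 1 7 3], [:: 1; 2; 37; 240; 258; 60; 248; 242;
   273; 249; 230; 313]); ([:: Ccw 1 7 3; Ccw 1 10 7; Ccw 0 10 1], [:: 5; 0;
   1; 2; 342; 311; 9; 53; 181; 190]); ([:: Ccw 1 3 7; Ccw 0 1 5], [:: 4; 0;
   1; 2; 154; 36; 83; 45; 96; 341; 91; 348; 350; 244; 346; 95; 73; 86; 283;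
   92; 252; 89; 93; 74; 343; 347; 162; 305; 46; 97; 284; 29; 77; 338; 197;
   322; 144; 340; 219]); ([:: Ccw 0 7 1; Ccw 1 7 3], [:: 43; 91; 354]);
   ([:: Ccw 1 5 4; Ccw 1 7 5; Ccw 1 5 2; Ccw 1 7 2; Ccw 2 7 5; Ccw 2 4 7;
   Ccw 1 4 2], [:: 238; 274; 184; 319]); ([:: Miss 0 1 4; Ccw 0 1 4; Ccw 0 10
   2; Ccw 0 1 10], [:: 0; 1; 2; 154; 103; 102; 14; 255]); ([:: Ccw 1 5 4;
   Ccw 1 7 2; Ccw 1 5 2; Ccw 1 7 5; Ccw 1 4 2; Ccw 2 20 5; Ccw 2 16 7],
   [:: 65; 80; 238; 274; 357; 64; 16; 319; 144; 217; 186]); ([:: Ccw 1 4 5;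
   Ccw 1 4 2; Ccw 1 5 2; Ccw 0 1 10; Ccw 0 10 2; Ccw 0 1 5], [:: 0; 1; 2;
   154; 36; 83; 12; 58; 268; 358; 198; 170; 203; 137; 136; 109; 110; 260; 81;
   23; 259; 264]); ([:: Ccw 2 3 7; Ccw 0 1 5], [:: 0; 1; 2; 154; 355; 27; 75;
   356; 51; 46; 97; 352; 173; 179; 209; 8; 146; 133; 114; 115; 44; 38; 65;
   57; 31; 223; 257; 360; 357; 359; 300; 89]); ([:: Ccw 2 5 7; Ccw 0 7 5;
   Ccw 3 7 5; Ccw 1 7 5; Ccw 1 7 3; Ccw 2 7 3; Ccw 1 5 2; Ccw 0 2 7], [:: 0;
   1; 2; 154; 168; 333; 291]); ([:: Ccw 1 2 7; Ccw 1 7 13; Ccw 5 13 7; Ccw 2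
   7 5; Ccw 0 2 7; Ccw 1 4 2; Ccw 1 13 3; Ccw 1 5 2; Ccw 0 1 5], [:: 6; 0; 1;
   2; 154; 355; 356; 361; 37; 84; 15; 63; 175; 216; 151; 150; 129; 130; 131;
   50; 33; 64; 67; 24; 238; 268; 345; 30; 78; 222; 189; 334; 199; 113; 139;
   112; 111; 104; 105; 265; 287; 47; 20; 49; 256; 241; 71; 224; 353]);
   ([:: Ccw 1 7 2; Ccw 1 7 13; Ccw 5 13 7; Ccw 2 7 5; Ccw 1 13 3; Ccw 1 5 2;
   Ccw 0 1 5; Ccw 3 13 5], [:: 4; 0; 1; 2; 154; 83; 355; 361; 28; 37; 84;
   134; 207; 216; 151; 130; 131; 50; 67; 24; 298; 40; 241; 269; 224; 353; 23;
   326; 71; 142; 196; 195]); ([:: Ccw 1 7 5; Ccw 3 13 5; Ccw 0 1 5; Ccw 1 13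
   3; Ccw 1 5 2], [:: 0; 1; 2; 355; 356; 361; 311; 164; 37; 84; 59; 13; 223;
   332; 362; 364; 124; 175; 363; 216; 31; 79; 150; 129; 213; 33; 64; 17; 235;
   182; 277]); ([:: Ccw 1 5 2; Ccw 0 1 5], [:: 0; 1; 2; 154; 36; 355; 356;
   361; 311; 164; 37; 267; 271; 85; 72; 365; 239; 263; 321; 41; 312; 314; 24;
   351]); ([:: Ccw 1 2 4; Ccw 2 5 4; Ccw 1 5 3; Ccw 0 1 5; Ccw 0 2 4], [:: 5;
   0; 1; 2; 154; 366; 79; 226; 276; 275; 288; 21; 69; 306; 138; 34; 81; 191;
   200]); ([:: Ccw 0 1 5], [:: 6; 0; 1; 2; 154; 36; 83; 355; 356; 361; 311;
   164; 366; 11; 57; 155; 158; 289; 201; 24; 73; 143; 123; 108; 351; 32; 62;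
   23; 239; 332; 16; 78; 303; 367; 15; 63; 229; 189; 323; 160; 316]);
   ([:: Ccw 0 3 5; Ccw 1 2 5], [:: 0; 1; 2; 154; 368; 10; 39; 87; 251; 289;
   107; 24; 73; 202; 165]); ([:: Ccw 2 5 3; Ccw 1 2 5; Ccw 0 3 7; Ccw 2 7 10;
   Ccw 1 7 2; Ccw 2 7 3], [:: 3; 0; 1; 2; 369; 71; 24; 73; 293; 309; 315;
   135; 90; 205; 218; 294]); ([:: Ccw 2 3 5; Ccw 1 2 5; Ccw 0 20 3; Ccw 0 2
   10; Ccw 0 5 20], [:: 4; 0; 1; 2; 154; 40; 89; 289; 196; 100; 195]);
   ([:: Ccw 2 7 3; Ccw 1 7 3; Ccw 1 2 5], [:: 0; 1; 2; 368; 369; 23; 71; 356;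
   311; 164; 8; 52; 371; 309; 307; 370; 169; 281; 221]); ([:: Ccw 1 7 3;
   Ccw 1 2 5], [:: 1; 57; 27; 75; 372; 46; 97; 173; 179; 209; 114]);
   ([:: Ccw 1 5 7; Ccw 5 20 7; Ccw 1 20 5; Ccw 0 5 20; Ccw 0 7 1], [:: 368;
   320; 246]); ([:: Ccw 1 4 5; Ccw 1 4 2; Ccw 1 7 2; Ccw 1 2 5; Ccw 2 7 5],
   [:: 63; 12; 225; 64; 16; 296; 302; 80; 184; 185; 220; 140]); ([:: Ccw 1 4
   2; Ccw 2 7 5; Ccw 1 7 2; Ccw 1 2 5], [:: 375; 229; 172]); ([:: Ccw 2 7 4;
   Ccw 1 2 4; Ccw 1 7 2; Ccw 1 21 7], [:: 31; 79; 65; 17; 171; 178; 147;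
   210]); ([:: Ccw 2 5 4; Ccw 2 16 7; Ccw 2 7 5; Ccw 4 7 16; Ccw 4 7 5; Hit 4
   5 7], [:: 64; 16; 185; 220]); ([:: Ccw 2 7 5; Ccw 1 2 5; Ccw 1 21 7; Ccw 1
   7 2; Ccw 0 7 2; Ccw 0 7 5; Ccw 3 7 5; Ccw 2 5 3; Ccw 2 3 7], [:: 0; 1; 2;
   154; 376; 377; 80; 33; 299; 301; 234; 94; 331; 152; 378; 325; 318; 310]);
   ([:: Ccw 1 4 5; Ccw 1 7 5; Ccw 1 3 5; Ccw 1 2 5; Ccw 4 10 7; Ccw 3 10 7;
   Ccw 1 10 7; Ccw 2 19 3; Ccw 1 2 4; Ccw 1 7 2], [:: 3; 1; 373; 96; 282;
   280; 147; 337; 35; 82; 22; 204; 211; 278]); ([:: Ccw 1 2 4; Ccw 1 21 7;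
   Ccw 2 3 7; Ccw 0 7 2; Ccw 1 7 2; Ccw 1 10 7; Ccw 3 10 7; Ccw 1 3 5; Ccw 1
   7 5; Ccw 1 2 5; Hit 2 5 7; Ccw 2 5 7], [:: 0; 1; 2; 154; 377; 80; 33; 299;
   301; 234; 70; 94; 380; 236; 324; 64; 16; 152; 217; 220]); ([:: Ccw 2 16 7;
   Ccw 1 7 2; Ccw 1 16 2; Hit 1 2 7; Ccw 1 4 16; Ccw 1 7 13], [:: 65; 208;
   80; 183; 215; 121]); ([:: Ccw 0 4 7; Ccw 2 7 4; Ccw 0 7 2], [:: 166;
   231]); ([:: Ccw 1 7 2; Ccw 2 5 3; Ccw 1 2 5; Ccw 1 7 5; Ccw 1 3 5; Ccw 3
   10 7; Ccw 2 3 7; Ccw 0 7 2; Ccw 0 7 1], [:: 0; 1; 2; 154; 368; 57; 373;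
   96; 91; 304; 98; 59; 227; 114; 379; 153; 381; 15; 63; 382; 33; 383; 245;
   329; 266; 272; 117; 250; 35; 82; 20; 68; 193; 161]); ([:: Ccw 2 7 4; Ccw 1
   4 2; Ccw 1 2 7; Ccw 0 7 2], [:: 0; 1; 2; 154; 383; 295; 245]); ([:: Ccw 1
   4 2; Ccw 0 7 2; Ccw 1 2 7; Ccw 1 7 13], [:: 15; 63; 385; 80; 33; 174; 176;
   121; 215]); ([:: Ccw 0 2 4; Ccw 0 4 1; Ccw 1 2 4; Ccw 2 4 7; Ccw 1 2 7;
   Ccw 0 7 2; Ccw 0 7 1], [:: 234; 317; 330]); ([:: Ccw 2 4 7; Ccw 2 7 5;
   Ccw 1 2 5; Ccw 0 7 1; Ccw 0 7 2; Ccw 1 2 7; Ccw 1 2 4], [:: 0; 1; 2; 154;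
   368; 31; 79; 292; 236; 58; 279; 116; 387; 14; 62; 192; 159]); ([:: Ccw 2 5
   3; Ccw 2 3 7; Ccw 1 2 5], [:: 4; 0; 1; 2; 154; 368; 369; 23; 373; 45; 96;
   341; 46; 307; 304; 88; 25; 374; 59; 227; 254; 26; 93; 74; 162; 197; 253;
   384; 335; 119; 386; 31; 79; 388; 65; 17; 213; 182; 210; 147]); ([:: Ccw 2
   3 5; Ccw 1 2 5; Ccw 0 20 3; Ccw 0 5 20], [:: 4; 0; 1; 2; 154; 11; 40; 89;
   289; 196; 126; 195]); ([:: Ccw 1 2 5], [:: 3; 1; 369; 23; 71; 373; 45; 96;
   390; 389; 28; 76; 206; 180; 214; 149; 120; 125; 42; 61; 66; 286; 247; 328;
   232]); ([::], [:: 6; 0; 1; 2; 154; 368; 10; 56; 391; 37; 84; 188; 167;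
   194; 251; 141; 101; 127; 128; 48; 55; 67; 24; 18; 297; 99; 19; 243; 339;
   233])].

(** * Absence of drawings *)

(** The orientation hypotheses involve vertices alone, where [g] agrees with [f], so they can be
    stated without the witnesses. *)
Lemma drawing_refutation (R : realType) (W : set (plane R)) (f : nat -> plane R)
    hyps rules steps :
  drawing W f -> refutation hyps rules steps ->
  all (fun l => if l is Ccw a b c then [&& a < 10, b < 10 & c < 10]%N else true)
    hyps ->
  List.Forall (satisfied W f f) hyps -> False.
Proof.
move=> D ref Hv Hs; have [g E] := drawing_extension D.
apply: (refutation_sound D E ref).
elim: hyps Hv Hs {ref} => [|l hyps IH] /=; first by constructor.
case/andP => lv hv /List.Forall_cons_iff[ls hs]; constructor; last exact: IH.
case: l lv ls => //= a b c /and3P[a10 b10 c10].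
by rewrite !(extension_vertex E).
Qed.

(** The red codes 6, 8 and 9 of this certificate are r14, r24 and r34, the neighbours of b4. *)
Lemma enclosed_refutation :
  refutation [:: Ccw 0 1 2; Hit 0 1 2] enclosed_rules enclosed_steps.
Proof. by vm_compute. Qed.

(** The blue points are in convex position in the cyclic order b1, b2, b3, b4. The red codes of this
    certificate are 5 and 8, that is r13 and r24, which belong to the two diagonals. *)
Lemma convex_refutation :
  refutation
    [:: Miss 1 2 3; Miss 0 2 3; Miss 0 1 3; Ccw 1 2 3; Ccw 0 2 3; Ccw 0 1 3;
        Ccw 0 1 2] convex_rules convex_steps.
Proof. by vm_compute. Qed.

(** The three orientations place b4 inside the triangle b1 b2 b3. [Ccw 0 3 2] is the normal form of
    the orientation of b3, b1, b4. *)
Lemma nonconvex_refutation :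
  refutation
    [:: Ccw 0 3 2; Ccw 1 2 3; Ccw 0 1 3; Miss 1 2 3; Miss 0 2 3; Miss 0 1 3;
        Miss 0 1 2] nonconvex_rules nonconvex_steps.
Proof. by vm_compute. Qed.

Lemma enclosed_blue_triangle (R : realType) (W : set (plane R))
    (f : nat -> plane R) :
  drawing W f -> 0 < orient (f 0%N) (f 1%N) (f 2%N) ->
  ~ meets_triangle W f 0 1 2.
Proof.
move=> D f012 m012.
by apply: (drawing_refutation D enclosed_refutation) => //; repeat constructor.
Qed.

(** The automorphism induced by a permutation [s] of the blue indices: r_A goes to the red vertex of
    the image of A. The image pair is sorted to be found in [red_ends]. *)
Definition relabel (s : seq nat) (i : nat) : nat :=
  if (i < 4)%N then nth 0%N s i
  else let e := nth (0, 0)%N red_ends (i - 4) in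
       let a := nth 0%N s e.1 in let b := nth 0%N s e.2 in
       (4 + index (minn a b, maxn a b) red_ends)%N.

Lemma relabel_automorphism (s : seq nat) (i j : nat) :
  perm_eq s (iota 0 4) -> (i < 10)%N -> (j < 10)%N ->
  [/\ (relabel s i < 10)%N, edge (relabel s i) (relabel s j) = edge i j &
      i != j -> relabel s i != relabel s j].
Proof.
rewrite -mem_permutations => sI i10 j10.
have iI : i \in iota 0 10 by rewrite mem_iota.
have jI : j \in iota 0 10 by rewrite mem_iota.
suff /and3P[ri /eqP eij /implyP] : [&& (relabel s i < 10)%N,
    edge (relabel s i) (relabel s j) == edge i j &
    (i != j) ==> (relabel s i != relabel s j)] by [].
have H : all (fun s => all (fun i => all (fun j => [&& (relabel s i < 10)%N,
    edge (relabel s i) (relabel s j) == edge i j &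
    (i != j) ==> (relabel s i != relabel s j)]) (iota 0 10)) (iota 0 10))
    (permutations (iota 0 4)) by vm_compute.
exact: (allP (allP (allP H s sI) i iI) j jI).
Qed.

Lemma drawing_relabel (R : realType) (W : set (plane R)) (f : nat -> plane R)
    (s : seq nat) :
  perm_eq s (iota 0 4) -> drawing W f -> drawing W (f \o relabel s).
Proof.
move=> sP D; pose rel i j := @relabel_automorphism s i j sP.
split=> [|i j k i10 j10 k10 ij jk ik|i j i10 j10 ij|i j i10 j10 ij nij].
- exact: drawing_connected D.
- have [ri _ /(_ ij) rij] := rel i j i10 j10.
  have [rj _ /(_ jk) rjk] := rel j k j10 k10.
  have [_ _ /(_ ik) rik] := rel i k i10 k10.
  have [rk _ _] := rel k i k10 i10.
  exact: (drawing_generic D).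
- have [ri rij _] := rel i j i10 j10; have [rj _ _] := rel j i j10 i10.
  by apply: (drawing_edge D); rewrite ?rij.
- have [ri rij /(_ ij) nrij] := rel i j i10 j10.
  have [rj _ _] := rel j i j10 i10.
  by apply: (drawing_nonedge D); rewrite ?rij.
Qed.

(** An automorphism carries b1, b2, b3 to the given blue vertices, in the order that makes the
    triangle counterclockwise. The index [l] is the remaining one and completes the permutation. *)
Lemma avoids_blue_triangle (R : realType) (W : set (plane R))
    (f : nat -> plane R) (i j k l : nat) :
  drawing W f -> perm_eq [:: i; j; k; l] (iota 0 4) ->
  ~ meets_triangle W f i j k.
Proof.
move=> D sP m.
have [p|p|p] := ltgtP 0 (orient (f i) (f j) (f k)).
- exact: (enclosed_blue_triangle (drawing_relabel sP D)).
- have sP' : perm_eq [:: i; k; j; l] (iota 0 4).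
    apply: perm_trans sP; rewrite perm_cons.
    by rewrite (perm_catCA [:: k] [:: j] [:: l]).
  apply: (enclosed_blue_triangle (drawing_relabel sP' D)).
    by rewrite /= orient_flip oppr_gt0.
  by case: m => x Wx [?|?]; exists x => //; [right|left].
- have /perm_mem sI := sP.
  have : orient (f i) (f j) (f k) != 0.
    have : uniq [:: i; j; k; l] by rewrite (perm_uniq sP).
    rewrite /= !inE !negb_or => /and4P[/and3P[ij ik _] /andP[jk _] _ _].
    have lt x : x \in [:: i; j; k; l] -> (x < 10)%N.
      by rewrite sI mem_iota => /andP[_ x4]; apply: (leq_trans x4).
    by apply: (drawing_generic D); rewrite ?lt // !inE eqxx ?orbT.
  by rewrite -p eqxx.
Qed.

Lemma blue_not_convex (R : realType) (W : set (plane R)) (f : nat -> plane R) :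
  drawing W f ->
  0 < orient (f 0%N) (f 1%N) (f 2%N) -> 0 < orient (f 0%N) (f 1%N) (f 3%N) ->
  0 < orient (f 0%N) (f 2%N) (f 3%N) -> 0 < orient (f 1%N) (f 2%N) (f 3%N) ->
  False.
Proof.
move=> D f012 f013 f023 f123.
apply: (drawing_refutation D convex_refutation) => //.
repeat constructor => //=.
- exact: (@avoids_blue_triangle _ _ _ _ _ _ 0%N).
- exact: (@avoids_blue_triangle _ _ _ _ _ _ 1%N).
- exact: (@avoids_blue_triangle _ _ _ _ _ _ 2%N).
Qed.

Lemma blue_not_nonconvex (R : realType) (W : set (plane R))
    (f : nat -> plane R) :
  drawing W f ->
  0 < orient (f 0%N) (f 1%N) (f 3%N) -> 0 < orient (f 1%N) (f 2%N) (f 3%N) ->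
  0 < orient (f 2%N) (f 0%N) (f 3%N) -> False.
Proof.
move=> D f013 f123 f203.
apply: (drawing_refutation D nonconvex_refutation) => //.
repeat constructor => //=.
- by rewrite orient_rot orient_rot.
- exact: (@avoids_blue_triangle _ _ _ _ _ _ 0%N).
- exact: (@avoids_blue_triangle _ _ _ _ _ _ 1%N).
- exact: (@avoids_blue_triangle _ _ _ _ _ _ 2%N).
- exact: (@avoids_blue_triangle _ _ _ _ _ _ 3%N).
Qed.

Lemma no_drawing (R : realType) (W : set (plane R)) (f : nat -> plane R) :
  ~ drawing W f.
Proof.
wlog f012 : f / 0 < orient (f 0%N) (f 1%N) (f 2%N) => [H D|D].
  have [p|p|p] := ltgtP 0 (orient (f 0%N) (f 1%N) (f 2%N)).
  - exact: (H f).
  (* Exchanging b1 and b2 reverses the orientation of the first three blue points. *)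
  - have s1 : perm_eq [:: 1; 0; 2; 3]%N (iota 0 4) by [].
    apply: (H _ _ (drawing_relabel s1 D)).
    by rewrite /= orient_swap oppr_gt0.
  - by have := drawing_generic D (isT : 0 < 10)%N (isT : 1 < 10)%N
      (isT : 2 < 10)%N isT isT isT; rewrite -p eqxx.
have convex s : perm_eq s (iota 0 4) ->
    let g := f \o relabel s in
    [/\ 0 < orient (g 0%N) (g 1%N) (g 2%N), 0 < orient (g 0%N) (g 1%N) (g 3%N),
        0 < orient (g 0%N) (g 2%N) (g 3%N) &
        0 < orient (g 1%N) (g 2%N) (g 3%N)] ->
    False.
  by move=> sP g [*]; exact: (blue_not_convex (drawing_relabel sP D)).
have nonconvex s : perm_eq s (iota 0 4) ->
    let g := f \o relabel s in
    [/\ 0 < orient (g 0%N) (g 1%N) (g 3%N), 0 < orient (g 1%N) (g 2%N) (g 3%N) &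
        0 < orient (g 2%N) (g 0%N) (g 3%N)] -> False.
  by move=> sP g [*]; exact: (blue_not_nonconvex (drawing_relabel sP D)).
have f013 := drawing_generic D (isT : 0 < 10)%N (isT : 1 < 10)%N
  (isT : 3 < 10)%N isT isT isT.
have f123 := drawing_generic D (isT : 1 < 10)%N (isT : 2 < 10)%N
  (isT : 3 < 10)%N isT isT isT.
have f203 := drawing_generic D (isT : 2 < 10)%N (isT : 0 < 10)%N
  (isT : 3 < 10)%N isT isT isT.
have S := orient_split (f 0%N) (f 1%N) (f 2%N) (f 3%N).
(* The three signs locate b4 among the lines of the triangle b1 b2 b3. With no negative sign it is
   inside; with one it is beyond a side and the points are in convex position; with two it is beyond
   a corner, which then lies in the triangle of the others. Three negative signs contradict the sum
   of the areas. *)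
have [a|a|/eqP] := ltgtP 0 (orient (f 0%N) (f 1%N) (f 3%N));
  last by rewrite eq_sym (negPf f013).
all: have [b|b|/eqP] := ltgtP 0 (orient (f 1%N) (f 2%N) (f 3%N));
  last by rewrite eq_sym (negPf f123).
all: have [c|c|/eqP] := ltgtP 0 (orient (f 2%N) (f 0%N) (f 3%N));
  last by rewrite eq_sym (negPf f203).
all: clear f013 f123 f203 S.
- by apply: (nonconvex [:: 0; 1; 2; 3]%N).
- apply: (convex [:: 0; 1; 2; 3]%N) => //=.
  by rewrite /orient in f012 a b c *; split; lra.
- apply: (convex [:: 0; 1; 3; 2]%N) => //=.
  by rewrite /orient in f012 a b c *; split; lra.
- apply: (nonconvex [:: 0; 1; 3; 2]%N) => //=.
  by rewrite /orient in f012 a b c *; split; lra.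
- apply: (convex [:: 0; 3; 1; 2]%N) => //=.
  by rewrite /orient in f012 a b c *; split; lra.
- apply: (nonconvex [:: 1; 2; 3; 0]%N) => //=.
  by rewrite /orient in f012 a b c *; split; lra.
- apply: (nonconvex [:: 0; 3; 2; 1]%N) => //=.
  by rewrite /orient in f012 a b c *; split; lra.
- rewrite /orient in f012 a b c; lra.
Qed.

(** * From obstacle representations to drawings *)

Definition red_set (k : nat) : {set 'I_4} := [set i | sees (val i) k]%SET.

Lemma card_red_set (k : nat) : (k < 6)%N -> #|red_set k| == 2.
Proof.
by case: k => [|[|[|[|[|[|k]]]]]] // _;
   rewrite cardsE -sum1_card big_mkcond !big_ord_recl big_ord0.
Qed.

(** The default is never reached for codes below 10, since [red_set] then has two elements. *)
Definition vertex_of (n : nat) : G3'_vertex :=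
  if (n < 4)%N then inl (inord n)
  else odflt (inl ord0) (omap inr (insub (red_set (n - 4)))).

Lemma vertex_of_red (n : nat) : (4 <= n < 10)%N ->
  exists2 A, vertex_of n = inr A & val A = red_set (n - 4).
Proof.
move=> /andP[n4 n10]; rewrite /vertex_of ltnNge n4 /=.
have H : #|red_set (n - 4)| == 2 by rewrite card_red_set // ltn_subLR.
by rewrite insubT /=; exists (Sub (red_set (n - 4)) H).
Qed.

Lemma G3'_adj_vertex_of (i j : nat) : (i < 10)%N -> (j < 10)%N ->
  G3'_adj (vertex_of i) (vertex_of j) = edge i j.
Proof.
have blue_red n m : (n < 4)%N -> (4 <= m < 10)%N ->
    G3'_adj (vertex_of n) (vertex_of m) = sees n (m - 4).
  move=> n4 /vertex_of_red[A -> AE].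
  by rewrite /vertex_of n4 /= AE inE /= inordK.
move=> i10 j10; rewrite /edge.
have [i4|i4] := ltnP i 4; have [j4|j4] := ltnP j 4.
- rewrite /vertex_of i4 j4 /= andbT; congr negb.
  by apply/eqP/eqP => [/(congr1 (@nat_of_ord 4))|->] //; rewrite !inordK.
- have -> : i != j by rewrite neq_ltn (leq_trans i4 j4).
  by rewrite blue_red // j4.
- have -> : i != j by rewrite neq_ltn (leq_trans j4 i4) orbT.
  by rewrite G3'_adj_sym blue_red // i4.
have [A -> AE] : exists2 A, vertex_of i = inr A & val A = red_set (i - 4).
  by apply: vertex_of_red; rewrite i4.
have [B -> BE] : exists2 B, vertex_of j = inr B & val B = red_set (j - 4).
  by apply: vertex_of_red; rewrite j4.
rewrite andbT /= -val_eqE AE BE.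
have [->|ij] := eqVneq i j; first by rewrite eqxx.
(* Distinct red codes are told apart by a blue index that belongs to only one of the two sets. *)
have /hasP[n] : has (fun n => sees n (i - 4) != sees n (j - 4)) (iota 0 4).
  have H : all (fun i => all (fun j => (i == j) ||
      has (fun n => sees n (i - 4) != sees n (j - 4)) (iota 0 4)) (iota 4 6))
      (iota 4 6) by [].
  have iI : i \in iota 4 6 by rewrite mem_iota i4.
  have jI : j \in iota 4 6 by rewrite mem_iota j4.
  by have := allP (allP H i iI) j jI; rewrite (negPf ij).
rewrite mem_iota /= => n4; apply: contraNneq => /setP/(_ (inord n)).
by rewrite !inE /= inordK // => ->.
Qed.

(** Distinct codes have distinct neighbourhoods, which is a finite check, and [vertex_of] preserves
    adjacency. *)
Lemma vertex_of_inj (i j : nat) : (i < 10)%N -> (j < 10)%N ->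
  vertex_of i = vertex_of j -> i = j.
Proof.
move=> i10 j10 ij; apply/eqP.
have H : all (fun i => all (fun j => (i == j) ||
    has (fun k => edge i k != edge j k) (iota 0 10)) (iota 0 10)) (iota 0 10).
  by vm_compute.
have iI : i \in iota 0 10 by rewrite mem_iota.
have jI : j \in iota 0 10 by rewrite mem_iota.
have /orP[//|/hasP[k]] := allP (allP H i iI) j jI.
rewrite mem_iota => /andP[_ k10].
by rewrite -!G3'_adj_vertex_of // ij eqxx.
Qed.

Lemma obstacle_representation_drawing (R : realType) (P : {fset plane R})
    (O : {fset seq (plane R)}) :
  obstacle_representation G3' P O -> (#|` O| <= 1)%N ->
  exists W f, @drawing R W f.
Proof.
move=> [simple disj gp [phi [[psi phiK psiK] iso]]] O1.
pose x i : P := psi (vertex_of i).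
have vis i j : (i < 10)%N -> (j < 10)%N ->
    edge i j = (x i != x j) && `[< visible O (val (x i)) (val (x j)) >].
  move=> i10 j10; rewrite -G3'_adj_vertex_of //.
  by move: (iso (x i) (x j)); rewrite /x !psiK; exact.
have xI i j : (i < 10)%N -> (j < 10)%N -> i != j -> x i != x j.
  move=> i10 j10; apply: contra_neq => /(can_inj psiK).
  exact: vertex_of_inj.
(* There is exactly one obstacle: with none, b1 and r23, of codes 0 and 7, would see each other. *)
have [s OE] : exists s, O = [fset s]%fset.
  move: O1; rewrite leq_eqVlt ltnS leqn0.
  case/orP => [/cardfs1P//|/eqP/cardfs0_eq O0].
  have := vis 0%N 7%N isT isT; rewrite xI //= => /esym/negP[].
  by apply/asboolP => s; rewrite O0 inE.
have sO : s \in O by rewrite OE inE.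
have [us _ _] := simple s sO.
have nreg p : p \in P -> ~ region s p.
  by move=> pP ps; have : ([set` P] `&` region s) p by []; rewrite disj.
exists (boundary s), (fun i => val (x i)); split.
- exact: connected_boundary.
- move=> i j k i10 j10 k10 ij jk ik; apply/eqP.
  have ne a b : (a < 10)%N -> (b < 10)%N -> a != b -> val (x a) <> val (x b).
    by move=> a10 b10 ab /val_inj/eqP; apply/negP; exact: xI.
  by apply: gp; try (by left; exact: valP); exact: ne.
- move=> i j i10 j10; rewrite vis // => /andP[_ /asboolP/(_ s sO) E].
  apply/seteqP; split=> // z [bz ijz].
  by rewrite -E; split=> //; left.
- move=> i j i10 j10 ij; rewrite vis // xI //= => /asboolPn nv.
  have [z [ijz bz]] : segment (val (x i)) (val (x j)) `&` boundary s !=set0.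
    apply: segment_region_boundary; first by apply: nreg; exact: valP.
    apply/set0P/negP => /eqP E; apply: nv => s'.
    by rewrite OE inE => /eqP ->.
  by exists z.
Qed.

Theorem theorem12 (R : realType) : (1%:E < obstacle_number R G3')%E.
Proof.
(* Excluding one obstacle at most gives 2 as a lower bound of these naturals. The bound passes to
   the infimum, whereas a strict bound by 1 need not. *)
apply: (@lt_le_trans _ _ 2%:E); first by rewrite lte_fin ltr1n.
apply/ereal_infP => _ [[P O] /= rep <-]; rewrite lee_fin ler_nat ltnNge.
apply/negP => O1; have [W [f D]] := obstacle_representation_drawing rep O1.
exact: (no_drawing D).
Qed.
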